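(* Let $c$ be an integer, let $N_c=11-c$, and let $n$ denote a positive integer. Then the following hold. (1) If $c>4$, then $B(n,n-c)=\emptyset$, except for $n=c$, in which case $B(n,0)$ consists of all the linear betweenness structures of order $n$. (2) If $2\le c\le4$, then $B(n,n-c)\ne\emptyset$ if and only if $n\ge c$. Further, if $n\ge N_c$, then the betweenness structures $\mathcal{B}\in B(n,n-c)$ are characterized, up to isomorphism, as follows: - if $c=4$, then $\mathcal{B}$ is isomorphic to either $\mathcal{R}_{n,i}^4$ (for some $i\in I_n^4$) or $\mathcal{S}_n^4$; - if $c=3$, then $\mathcal{B}$ is isomorphic to either $\mathcal{Q}_n^3$, $\mathcal{R}_{n,i}^3$ (for some $i\in I_n^3$) or $\mathcal{S}_n^3$; - if $c=2$, then $\mathcal{B}$ is isomorphic to either $\mathcal{Q}_n^2$, $\mathcal{R}_{n,i}^2$ (for some $i\in I_n^2$) or $\mathcal{S}_n^2$. (3) If $c<2$ and $n\ge N_c$, then $B(n,n-c)=\emptyset$. (4) If $c\le4$ and $n=N_c-1$, then $B(n,n-c)\ne\emptyset$. Moreover, there exists a betweenness structure $\mathcal{B}\in B(n,n-c)$ such that $\mathcal{H}(\mathcal{B})$ is not a tight star.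
   Context: A betweenness structure is a pair $\mathcal{B}=(X,\beta)$ where $X$ is a nonempty finite set and $\beta\subseteq X^3$; write $(x\ y\ z)$ for $(x,y,z)\in\beta$. All betweenness structures are assumed to be almost-metrizable, i.e. for all $x,y,z,w\in X$: (P1) $(x\ x\ z)$; (P2) $(x\ y\ z)\Rightarrow(z\ y\ x)$; (P3) $(x\ y\ z)\wedge(y\ x\ z)\Rightarrow x=y$; (P4) $(x\ y\ z)\wedge(x\ w\ y)\Rightarrow(x\ w\ z)\wedge(w\ y\ z)$. The order of $\mathcal{B}$ is $|X|$. A set of three distinct points is collinear if some ordering of it is in $\beta$; otherwise it is a triangle. The co-size of $\mathcal{B}$ is its number of triangles; $\mathcal{B}$ is linear if its co-size is $0$. $\mathcal{H}(\mathcal{B})$ is the $3$-uniform hypergraph on $X$ whose edges are the triangles of $\mathcal{B}$. $B(n,m)$ is the set of betweenness structures of order $n$ and co-size $m$ (empty if $m<0$). Isomorphisms are bijections of ground sets preserving betweenness in both directions. A $3$-uniform hypergraph is a $\Delta$-star if there is a set $K$ of vertices (the kernel) such that $E\cap F=K$ for any two distinct edges $E,F$; it is a tight star if it is a $\Delta$-star with kernel of size $2$. A hypergraph with exactly one edge is regarded as a tight star. Graphs are connected with positive real edge weights (weight $1$ unless specified). For a graph $W$ with shortest-path metric $d_W$ (path length is the sum of edge weights), the betweenness structure $\mathcal{B}(W)$ induced by $W$ lives on the vertex set and has $(x\ y\ z)$ iff $d_W(x,z)=d_W(x,y)+d_W(y,z)$. Let $I_n^2=I_n^4=\{i\in\mathbb{N}:1\le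 i\le\lceil\frac{n-3}{2}\rceil\}$ and $I_n^3=\{i\in\mathbb{N}:1\le i\le n-3\}$. The following graphs have vertex set $\{x_1,\dots,x_{n-2},y,z\}$ and are obtained from the path $P=x_1x_2\ldots x_{n-2}$: - $R_{n,i}^4$ ($n\ge5$, $i\in I_n^4$): delete edge $\{x_i,x_{i+1}\}$ and add edges $\{y,x_i\},\{z,x_i\},\{y,x_{i+1}\},\{z,x_{i+1}\}$; - $S_n^4$ ($n\ge5$): add edges $\{x_1,y\},\{x_{n-2},z\}$, and add edge $\{y,z\}$ of weight $n-3$; - $Q_n^3$ ($n\ge4$): add edges $\{y,x_1\}$ and $\{z,x_1\}$; - $R_{n,i}^3$ ($n\ge4$, $i\in I_n^3$): delete edge $\{x_i,x_{i+1}\}$, add edges $\{y,x_i\},\{z,x_i\}$, and add edges $\{y,x_{i+1}\},\{z,x_{i+1}\}$ of weight $2$; - $S_n^3$ ($n\ge4$): add edge $\{x_1,y\}$, and add edge $\{x_{n-2},z\}$ of weight $2$ and edge $\{y,z\}$ of weight $n-2$; - $Q_n^2$ ($n\ge3$): add edges $\{y,x_1\},\{z,x_1\}$ and $\{y,z\}$; - $R_{n,i}^2$ ($n\ge4$, $i\in I_n^2$): delete edge $\{x_i,x_{i+1}\}$, and add edges $\{y,x_i\},\{z,x_i\},\{y,x_{i+1}\},\{z,x_{i+1}\}$ and $\{y,z\}$; - $S_n^2$ ($n\ge3$): add edges $\{x_1,y\},\{x_{n-2},z\}$, and add edge $\{y,z\}$ of weight $n-2$. $\mathcal{Q}_n^c,\mathcal{R}_{n,i}^c,\mathcal{S}_n^c$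 are the betweenness structures induced by $Q_n^c,R_{n,i}^c,S_n^c$. *)

(* Defs.v *)
(* The real numbers are an abstract [R : realType]. *)
From HB Require Import structures.
From mathcomp Require Import all_boot all_order all_algebra.
From mathcomp Require Import classical_sets reals.

Set Implicit Arguments.
Unset Strict Implicit.
Unset Printing Implicit Defensive.

Import Order.TTheory GRing.Theory Num.Theory.
Local Open Scope ring_scope.

(* A finite set with a ternary relation; the axioms of a betweenness structure
   are the separate predicate [betweenness]. *)
Record structure := Structure {
  point :> finType;
  btw : point -> point -> point -> bool
}.

Definition betweenness (S : structure) : Prop :=
  [/\ (0 < #|S|)%N,
      forall x z : S, btw x x z,
      forall x y z : S, btw x y z -> btw z y x,
      forall x y z : S, btw x y z -> btw y x z -> x = y
    & forall x y z w : S, btw x y z -> btw x w y -> btw x w z /\ btw w y z].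

Definition order_of (S : structure) : nat := #|S|.

(* Meaningful when #|A| = 3: then A = {x, y, z} forces x, y, z to be distinct,
   that is, (x, y, z) is an ordering of A. *)
Definition collinear (S : structure) (A : {set S}) : bool :=
  [exists x : S, [exists y : S, [exists z : S,
    (A == [set x; y; z]) && btw x y z]]].

(* This is also the edge set of the hypergraph H(S). *)
Definition triangles (S : structure) : {set {set S}} :=
  [set A : {set S} | (#|A| == 3) && ~~ collinear A].

Definition cosize (S : structure) : nat := #|triangles S|.

Definition linear_structure (S : structure) : Prop := cosize S = 0%N.

(* The class B(n, m); it is empty for m < 0 because cosize is a natural
   number. *)
Definition in_B (n : nat) (m : int) (S : structure) : Prop :=
  [/\ betweenness S, order_of S = n & (cosize S)%:Z = m].

Definition isomorphic (S T : structure) : Prop :=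
  exists2 f : S -> T, bijective f &
    forall x y z : S, btw (f x) (f y) (f z) = btw x y z.

Definition delta_star (T : finType) (H : {set {set T}}) (K : {set T}) : Prop :=
  forall E F : {set T}, E \in H -> F \in H -> E != F -> E :&: F = K.

Definition tight_star (T : finType) (H : {set {set T}}) : Prop :=
  #|H| = 1%N \/ exists2 K : {set T}, #|K| = 2 & delta_star H K.

(* A weighted graph is given by its symmetric weight function: u and v are
   adjacent when [0 < weight u v], and non-adjacent when the weight is 0. *)
Record wgraph (R : realType) := WGraph {
  vertex : finType;
  weight : vertex -> vertex -> R;
  weight_sym : forall u v, weight u v = weight v u
}.

Definition adj (R : realType) (W : wgraph R) : rel (vertex W) :=
  fun u v => 0 < weight u v.

Fixpoint path_length (R : realType) (W : wgraph R) (u : vertex W)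
    (p : seq (vertex W)) : R :=
  if p is v :: q then weight u v + path_length v q else 0.

(* The infimum is over the finite set of lengths of simple paths from u to v,
   so it is a minimum as soon as u and v are connected. *)
Definition dist (R : realType) (W : wgraph R) (u v : vertex W) : R :=
  inf [set l : R | exists p : seq (vertex W),
         [/\ path (@adj R W) u p, last u p = v, uniq (u :: p)
           & l = path_length u p]]%classic.

Definition induced (R : realType) (W : wgraph R) : structure :=
  @Structure (vertex W) (fun x y z => dist x z == dist x y + dist y z).

(* Vertex names: x_1, x_2, ... (indexed from 1 as usual), y and z. *)
Definition label : Type := (nat + bool)%type.
Definition vx (i : nat) : label := inl i.
Definition vy : label := inr false.
Definition vz : label := inr true.

Definition labels (n : nat) : seq label :=
  [seq vx i | i <- iota 1 (n - 2)] ++ [:: vy; vz].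

(* ((a, b), w) stands for an undirected edge {a, b} of weight w. *)
Definition edge : Type := (label * label * nat)%type.

(* Each edge of the lists used below occurs once and in one direction, so the
   sum has at most one term. *)
Definition list_weight (R : realType) (n : nat) (E : seq edge)
    (u v : seq_sub (labels n)) : R :=
  \sum_(e <- E | (e.1 == (val u, val v)) || (e.1 == (val v, val u))) e.2%:R.

Lemma list_weight_sym (R : realType) (n : nat) (E : seq edge)
    (u v : seq_sub (labels n)) : list_weight R E u v = list_weight R E v u.
Proof. by apply: eq_bigl => e; rewrite orbC. Qed.

Definition graph_of (R : realType) (n : nat) (E : seq edge) : wgraph R :=
  @WGraph R (seq_sub (labels n)) (@list_weight R n E) (@list_weight_sym R n E).

Local Open Scope nat_scope.

Definition path_edges (n : nat) : seq edge :=
  [seq (vx i, vx i.+1, 1) | i <- iota 1 (n - 3)].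

Definition path_edges_del (n i : nat) : seq edge :=
  [seq e <- path_edges n | e.1 != (vx i, vx i.+1)].

Definition R4_edges (n i : nat) : seq edge :=
  path_edges_del n i ++
  [:: (vy, vx i, 1); (vz, vx i, 1); (vy, vx i.+1, 1); (vz, vx i.+1, 1)].

Definition S4_edges (n : nat) : seq edge :=
  path_edges n ++ [:: (vx 1, vy, 1); (vx (n - 2), vz, 1); (vy, vz, n - 3)].

Definition Q3_edges (n : nat) : seq edge :=
  path_edges n ++ [:: (vy, vx 1, 1); (vz, vx 1, 1)].

Definition R3_edges (n i : nat) : seq edge :=
  path_edges_del n i ++
  [:: (vy, vx i, 1); (vz, vx i, 1); (vy, vx i.+1, 2); (vz, vx i.+1, 2)].

Definition S3_edges (n : nat) : seq edge :=
  path_edges n ++ [:: (vx 1, vy, 1); (vx (n - 2), vz, 2); (vy, vz, n - 2)].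

Definition Q2_edges (n : nat) : seq edge :=
  path_edges n ++ [:: (vy, vx 1, 1); (vz, vx 1, 1); (vy, vz, 1)].

Definition R2_edges (n i : nat) : seq edge :=
  path_edges_del n i ++
  [:: (vy, vx i, 1); (vz, vx i, 1); (vy, vx i.+1, 1); (vz, vx i.+1, 1);
      (vy, vz, 1)].

Definition S2_edges (n : nat) : seq edge :=
  path_edges n ++ [:: (vx 1, vy, 1); (vx (n - 2), vz, 1); (vy, vz, n - 2)].

Definition induced_of (R : realType) (n : nat) (E : seq edge) : structure :=
  induced (graph_of R n E).

Definition struct_R4 (R : realType) n i := induced_of R n (R4_edges n i).
Definition struct_S4 (R : realType) n := induced_of R n (S4_edges n).
Definition struct_Q3 (R : realType) n := induced_of R n (Q3_edges n).
Definition struct_R3 (R : realType) n i := induced_of R n (R3_edges n i).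
Definition struct_S3 (R : realType) n := induced_of R n (S3_edges n).
Definition struct_Q2 (R : realType) n := induced_of R n (Q2_edges n).
Definition struct_R2 (R : realType) n i := induced_of R n (R2_edges n i).
Definition struct_S2 (R : realType) n := induced_of R n (S2_edges n).

(* [uphalf k] is the ceiling of k / 2. *)
Definition I2 (n i : nat) : bool := 1 <= i <= uphalf (n - 3).
Definition I4 (n i : nat) : bool := 1 <= i <= uphalf (n - 3).
Definition I3 (n i : nat) : bool := 1 <= i <= n - 3.

(* Main.v *)
(* A structure of order n with between 1 and 2n - 11 triangles has a point y
   whose removal leaves a linear structure, and a linear structure of order at
   least 5 is a line p_0, ..., p_{N-1}. The first fact is an induction on n
   which uses that adding a point to a line creates no triangle or at least
   N - 3 of them. So the structure is given by the table of the positions of y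
   relative to the pairs (p_a, p_b), and (P4) relates the entries of the table
   at (a, b), (b, c) and (a, c). With at most 2N - 8 triangles, an inclusion
   minimal pair having y between its points has length 1 (y is on the line),
   length 2 (a graph R) or N - 1; in the last case, or if there is no such
   pair, the consecutive pairs all have y on the same side, except perhaps at
   one end of the line (a graph Q or S). Isomorphism only depends on the table,
   and the table of each graph is read off its metric, which is that of points
   on a line except for the distance between y and z. For (4), two adjacent
   pairs of twins on a line give 2n - 10 triangles and no tight star. *)
Require Import Defs.
From mathcomp Require Import classical_sets reals.
From mathcomp Require Import all_boot all_order all_algebra.
From mathcomp Require Import zify.
Import Order.TTheory GRing.Theory Num.Theory.

(** The threshold N_c = 11 - c is the least n with n - c <= 2n - 11. That bound comes from the
    search for y: if deleting two points leaves a line while deleting either one alone does not,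
    these two points account for at least n - 5 triangles each, 2n - 10 in all, and the two pairs of
    twins attain this value. The tables themselves would tolerate 2N - 8 = 2n - 10 triangles. The
    values c = 2, 3, 4 come from the letters that the rules leave open: two for each graph R or S,
    one for Q. Every open letter costs one triangle or none, so the co-size is n - 4, n - 3 or n -
    2. Two obstacles shape the details. A linear structure of order 4 may be a 4-cycle instead of a
    line, so lines are built from five points on. And one structure may have several tables, through
    reversal of the line or through another choice of y; this explains the halved index ranges for c
    = 2 and 4, and the two tables of S3. *)

Section Development.
Set Implicit Arguments.
Unset Strict Implicit.
Unset Printing Implicit Defensive.
Local Open Scope nat_scope.

(** * Position of a point relative to a line *)

(* The position of a point y relative to two points u and v of a line, with u
   before v: before u, after v, between them, or forming a triangle. *)
Inductive letter := L | R | M | O.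

Definition swap (l : letter) : letter :=
  match l with L => R | R => L | M => M | O => O end.

Definition isO (l : letter) : bool := if l is O then true else false.

Definition same_table (N : nat) (t t' : nat -> nat -> letter) : Prop :=
  forall a b, a < b < N -> t a b = t' a b.

(** What (P4) says about y and three points of the line taken in order. The rules come in mirror
    pairs, exchanged by reversing the line, and the analysis of tables uses nothing else about
    betweenness. *)
Record place_rules (N : nat) (t : nat -> nat -> letter) : Prop := PlaceRules {
  placeLs : forall a b c, a < b -> b < c -> c < N -> t a c = L -> t a b = L /\ t b c = L;
  placeLc : forall a b c, a < b -> b < c -> c < N -> t a b = L -> t b c = L -> t a c = L;
  placeRs : forall a b c, a < b -> b < c -> c < N -> t a c = R -> t a b = R /\ t b c = R;
  placeRc : forall a b c, a < b -> b < c -> c < N -> t a b = R -> t b c = R -> t a c = R;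
  placeMl : forall a b c, a < b -> b < c -> c < N -> t a b = M -> t a c = M /\ t b c = L;
  placeMr : forall a b c, a < b -> b < c -> c < N -> t b c = M -> t a c = M /\ t a b = R;
  placeRM : forall a b c, a < b -> b < c -> c < N -> t a c = M -> t a b = R -> t b c = M;
  placeML : forall a b c, a < b -> b < c -> c < N -> t a c = M -> t b c = L -> t a b = M }.

Definition off_pairs (N : nat) (t : nat -> nat -> letter) : seq (nat * nat) :=
  [seq e <- allpairs pair (iota 0 N) (iota 0 N) | (e.1 < e.2) && isO (t e.1 e.2)].

(** A line has no triangle of its own, so this is the number of all triangles of the line together
    with y. *)
Definition off (N : nat) (t : nat -> nat -> letter) : nat := size (off_pairs N t).

Definition rev_table (N : nat) (t : nat -> nat -> letter) (a b : nat) : letter :=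
  swap (t (N.-1 - b) (N.-1 - a)).

(* y lies on the line, between the points k and k+1. *)
Definition tab_ins (k a b : nat) : letter :=
  if b <= k then R else if k < a then L else M.

(* The graphs R, the points y and k being twins: u and v tell whether the
   neighbours of k on the line are between them. *)
Definition tab_R (k : nat) (u v : letter) (a b : nat) : letter :=
  if a == k then (if b == k.+1 then v else O)
  else if b == k then (if a == k.-1 then u else O)
  else if b < k then R else if k < a then L else M.

(* The graphs Q, the points y and 0 being twins. *)
Definition tab_Q (x : letter) (a b : nat) : letter :=
  if 0 < a then L else if b == 1 then x else O.

(* The graphs S, the line being closed up to a cycle by y, next to 0. *)
Definition tab_S (N : nat) (x z : letter) (a b : nat) : letter :=
  if b < N.-1 then L
  else if a == 0 then z else if a == N.-2 then x else O.

Lemma off_pairsP N t a b :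
  ((a, b) \in off_pairs N t) = (a < b < N) && isO (t a b).
Proof.
rewrite mem_filter /= [RHS]andbAC [LHS]andbC [RHS]andbC.
have -> : ((a, b) \in allpairs pair (iota 0 N) (iota 0 N)) = (a < N) && (b < N).
  apply/allpairsP/idP => [[[i j] /= [+ + [-> ->]]]|]; rewrite ?mem_iota //.
    by move=> h h'; lia.
  by case/andP=> ha hb; exists (a, b); rewrite !mem_iota /= ha hb.
by case: isO; rewrite ?andbF ?andbT //; lia.
Qed.

Lemma off_ge N t (s : seq (nat * nat)) : uniq s ->
  (forall a b, (a, b) \in s -> a < b < N /\ t a b = O) -> size s <= off N t.
Proof.
move=> us hs; apply: uniq_leq_size => // -[a b] /hs [h e].
by rewrite off_pairsP h e.
Qed.

Lemma uniq_off_pairs N t : uniq (off_pairs N t).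
Proof.
apply/filter_uniq/allpairs_uniq; try exact: iota_uniq.
by case=> a b [c d] _ _.
Qed.

Lemma off_eq N t (s : seq (nat * nat)) : uniq s ->
  (forall a b, (a, b) \in s = (a < b < N) && isO (t a b)) -> off N t = size s.
Proof.
move=> us hs; apply/eqP; rewrite -(uniq_size_uniq us) ?uniq_off_pairs //.
by case=> a b; rewrite hs off_pairsP.
Qed.

Lemma off_same N t t' : same_table N t t' -> off N t = off N t'.
Proof.
move=> h; apply: off_eq => [|a b]; first exact: uniq_off_pairs.
by rewrite off_pairsP; case lt: (_ < _ < _) => //=; rewrite h.
Qed.

Lemma swapK : involutive swap. Proof. by case. Qed.

Lemma place_rev N t : place_rules N t -> place_rules N (rev_table N t).
Proof.
have sE l l' : swap l = l' <-> l = swap l' by case: l; case: l'.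
case=> h1 h2 h3 h4 h5 h6 h7 h8.
split=> a b c ab bc cN; rewrite /rev_table !sE /=.
- by move/(h3 _ (N.-1 - b)) => []; try lia.
- by move=> h h'; apply: (h4 _ (N.-1 - b)) => //; lia.
- by move/(h1 _ (N.-1 - b)) => []; try lia.
- by move=> h h'; apply: (h2 _ (N.-1 - b)) => //; lia.
- by move/(h6 (N.-1 - c)) => []; try lia.
- by move/(fun h p q => h5 _ _ (N.-1 - a) p q h) => []; try lia.
- by move=> h h'; apply: (h8 _ _ (N.-1 - a)) => //; lia.
- by move=> h h'; apply: (h7 (N.-1 - c)) => //; lia.
Qed.

Definition rect (i l j m : nat) : seq (nat * nat) := allpairs pair (iota i l) (iota j m).

Lemma mem_rect i l j m a b :
  ((a, b) \in rect i l j m) = (i <= a < i + l) && (j <= b < j + m).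
Proof.
apply/allpairsP/idP => [[[c d] /= [+ + [-> ->]]]|]; rewrite ?mem_iota.
  by move=> -> ->.
by case/andP=> ha hb; exists (a, b); rewrite !mem_iota /= ha hb.
Qed.

Lemma uniq_rect i l j m : uniq (rect i l j m).
Proof.
apply/allpairs_uniq; try exact: iota_uniq.
by case=> a b [c d] _ _.
Qed.

Lemma size_rect i l j m : size (rect i l j m) = l * m.
Proof. by rewrite size_allpairs !size_iota. Qed.

(** * Letters around a minimal pair that has y between its points *)

Section Table.
Context (N : nat) (t : nat -> nat -> letter) (Pt : place_rules N t).

Lemma L_sub a b c d : a <= b -> b < c -> c <= d -> d < N -> t a d = L -> t b c = L.
Proof.
move=> ab bc cd dN h.
have {}h : t a c = L.
  case: (ltngtP c d) cd => // [cd _|-> //].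
  by case: (placeLs Pt _ cd dN h) => //; lia.
case: (ltngtP a b) ab => // [ab _|<- //].
by case: (placeLs Pt ab bc _ h) => //; lia.
Qed.

Lemma R_sub a b c d : a <= b -> b < c -> c <= d -> d < N -> t a d = R -> t b c = R.
Proof.
move=> ab bc cd dN h.
have {}h : t a c = R.
  case: (ltngtP c d) cd => // [cd _|-> //].
  by case: (placeRs Pt _ cd dN h) => //; lia.
case: (ltngtP a b) ab => // [ab _|<- //].
by case: (placeRs Pt ab bc _ h) => //; lia.
Qed.

Lemma L_run a b : a < b < N -> (forall k, a <= k < b -> t k k.+1 = L) -> t a b = L.
Proof.
move=> /andP[]; elim: b => [|b IH] //; rewrite ltnS leq_eqVlt.
case/orP => [/eqP <- bN h|ab bN h]; first by apply: h; lia.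
apply: (placeLc Pt ab) => //; last by apply: h; lia.
by apply: IH => //; try lia; move=> k hk; apply: h; lia.
Qed.

Definition min_mid i j :=
  [/\ i < j < N, t i j = M
    & forall a b, i <= a < b -> b <= j -> t a b = M -> a = i /\ b = j].

Lemma min_mid_exists a b : a < b < N -> t a b = M -> exists i j, min_mid i j.
Proof.
move: {-1}(b - a) (leqnn (b - a)) => m; elim: m a b => [|m IH] a b hm hab e; first lia.
(* A search through the finitely many shorter pairs makes this alternative decidable. *)
have [[c [d [h1 h2]]]|h] : (exists c d, (a <= c < d /\ d <= b /\ d - c < b - a) /\ t c d = M)
    \/ (forall c d, a <= c < d -> d <= b -> d - c < b - a -> t c d <> M).
- pose s := [seq e <- rect a (b - a) a (b - a).+1
    | [&& e.1 < e.2, e.2 - e.1 < b - a & if t e.1 e.2 is M then true else false]].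
  case es: s => [|[c d] s'].
    right=> c d h1 h2 h3 h4; have : (c, d) \in s.
      by rewrite mem_filter mem_rect /= h4; lia.
    by rewrite es.
  have : (c, d) \in s by rewrite es mem_head.
  rewrite mem_filter mem_rect /= => h; left; exists c, d.
  by case: (t c d) h; split=> //; lia.
- by apply: (IH c d) h2; lia.
exists a, b; split=> // c d h1 h2 h3.
case: (ltnP (d - c) (b - a)) => h4; last lia.
by case: (h c d).
Qed.

Section MinMid.
Context (i j : nat) (mm : min_mid i j).

(** Outside the open interval from i to j the letters are forced by the single entry M at (i, j);
    minimality is not involved in this lemma and the next two. *)
Lemma mm_left a b : a < b -> b <= i -> t a b = R.
Proof.
case: mm => h1 h2 h3 ab bi.
apply: (@R_sub a _ _ i) => //; first lia.
by case: (@placeMr _ _ Pt a i j) => //; lia.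
Qed.

Lemma mm_right a b : a < b < N -> j <= a -> t a b = L.
Proof.
case: mm => h1 h2 h3 ab bi.
apply: (@L_sub j _ _ b) => //; try lia.
by case: (@placeMl _ _ Pt i j b) => //; lia.
Qed.

Lemma mm_across a b : a <= i -> j <= b < N -> t a b = M.
Proof.
case: mm => h1 h2 h3 ai jb.
have {}h2 : t i b = M.
  case: (ltngtP j b) jb => //= [jb bN|<- //].
  by case: (@placeMl _ _ Pt i j b) => //; lia.
case: (ltngtP a i) ai => // [ai _|-> //].
by case: (@placeMr _ _ Pt a i b) => //; lia.
Qed.

(** Here minimality enters: R at (i, k) would put y between k and j by [placeRM], and M at (i, k) is
    excluded directly. *)
Lemma mm_inL k : i < k < j -> t i k = L \/ t i k = O.
Proof.
case: mm => h1 h2 h3 hk.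
case e: (t i k); auto.
  have e' : t k j = M by apply: (@placeRM _ _ Pt i k j) => //; lia.
  by case: (h3 k j) => //; lia.
by case: (h3 i k) => //; lia.
Qed.

Lemma mm_inR k : i < k < j -> t k j = R \/ t k j = O.
Proof.
case: mm => h1 h2 h3 hk.
case e: (t k j); auto.
  have e' : t i k = M by apply: (@placeML _ _ Pt i k j) => //; lia.
  by case: (h3 i k) => //; lia.
by case: (h3 k j) => //; lia.
Qed.

(** A pair that straddles i and ends inside the interval has no consistent letter: L contradicts R
    at (a, i), R contradicts [mm_inL], and M would yield the shorter pair (i, k). *)
Lemma mm_offL a k : a < i -> i < k < j -> t a k = O.
Proof.
case: mm => h1 h2 h3 ai hk.
have r : t a i = R by apply: mm_left.
case e: (t a k) => //.
- by have : t a i = L; [apply: (L_sub _ _ _ _ e) => //; lia|rewrite r].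
- have e' : t i k = R by apply: (R_sub _ _ _ _ e) => //; lia.
  by case: (mm_inL hk); rewrite e'.
- have e' : t i k = M by apply: (@placeRM _ _ Pt a i k) => //; lia.
  by case: (h3 i k) => //; lia.
Qed.

Lemma mm_offR k b : j < b < N -> i < k < j -> t k b = O.
Proof.
case: mm => h1 h2 h3 ai hk.
have r : t j b = L by apply: mm_right => //; lia.
case e: (t k b) => //.
- have e' : t k j = L by apply: (L_sub _ _ _ _ e) => //; lia.
  by case: (mm_inR hk); rewrite e'.
- by have : t j b = R; [apply: (R_sub _ _ _ _ e) => //; lia|rewrite r].
- have e' : t k j = M by apply: (@placeML _ _ Pt k j b) => //; lia.
  by case: (h3 k j) => //; lia.
Qed.

Lemma mm_long : 3 <= j - i <= N - 2 -> 2 * N - 7 <= off N t.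
Proof.
move=> hl; case: (mm) => h1 h2 h3.
(* With l = j - i, the two rectangles give (N - 1 - l)(l - 1) triangles, and f gives l - 2
   more since t i k.+1 = L and t k j = R exclude each other. *)
pose f k := if t i k.+1 is L then (k, j) else (i, k.+1).
pose s := rect 0 i i.+1 (j - i).-1 ++ rect i.+1 (j - i).-1 j.+1 (N.-1 - j)
  ++ map f (iota i.+1 (j - i).-2).
have fP k : (f k = (k, j) /\ t i k.+1 = L) \/ (f k = (i, k.+1) /\ t i k.+1 <> L).
  by rewrite /f; case: (t i k.+1); [left|right|right|right].
have : size s <= off N t.
  apply: off_ge.
    rewrite !cat_uniq !uniq_rect /= has_cat negb_or -!all_predC -!andbA /=.
    apply/and4P; split.
    - by apply/allP=> -[a b]; rewrite mem_rect /= mem_rect; lia.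
    - apply/allP=> _ /mapP [k + ->] /=; rewrite mem_iota => hk.
      by case: (fP k) => -[-> _]; rewrite mem_rect; lia.
    - apply/allP=> _ /mapP [k + ->] /=; rewrite mem_iota => hk.
      by case: (fP k) => -[-> _]; rewrite mem_rect; lia.
    rewrite map_inj_in_uniq ?iota_uniq // => a b; rewrite !mem_iota => ha hb.
    by case: (fP a) => -[-> _]; case: (fP b) => -[-> _] [] *; lia.
  move=> a b; rewrite !mem_cat !mem_rect => /or3P[] h.
  - by split; [lia|apply: mm_offL; lia].
  - by split; [lia|apply: mm_offR; lia].
  move: h => /mapP [k]; rewrite mem_iota => hk.
  case: (fP k) => -[-> e] [-> ->]; (split; first lia).
  - have hk' : i < k < j by lia.
    case: (mm_inR hk') => // e'.
    case: (ltngtP k.+1 j) => // hkj; try lia.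
    have : t k k.+1 = R by apply: (R_sub _ _ _ _ e') => //; lia.
    have -> // : t k k.+1 = L by apply: (L_sub _ _ _ _ e) => //; lia.
  - have hk' : i < k.+1 < j by lia.
    by case: (mm_inL hk').
(* The total (N - 1 - l)(l - 1) + (l - 2) is concave in l and equals 2N - 7 at both extremes, l = 3
   and l = N - 2. *)
rewrite !size_cat !size_rect size_map size_iota => h; nia.
Qed.

End MinMid.
End Table.

(** The first two cases are the tables of a linear structure. In the others the parameters are the
    letters that the rules do not determine; each is either a fixed collinear position or O. *)
Inductive pattern (N : nat) (t : nat -> nat -> letter) : Prop :=
| PatL of same_table N t (fun _ _ => L)
| PatIns k of k.+1 < N & same_table N t (tab_ins k)
| PatR k u v of 0 < k & k.+1 < N & (u = L \/ u = O) & (v = R \/ v = O)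
    & same_table N t (tab_R k u v)
| PatQ x of x = R \/ x = O & same_table N t (tab_Q x)
| PatS x z of x = R \/ x = O & z = M \/ z = O & same_table N t (tab_S N x z).

Section Pattern.
Context (N : nat) (t : nat -> nat -> letter) (Pt : place_rules N t) (N4 : 4 <= N).

Lemma mid_dec : (exists a b, a < b < N /\ t a b = M) \/ (forall a b, a < b < N -> t a b <> M).
Proof.
pose s := [seq e <- rect 0 N 0 N | (e.1 < e.2) && if t e.1 e.2 is M then true else false].
case es: s => [|[c d] s'].
  right=> c d h1 h2; have : (c, d) \in s by rewrite mem_filter mem_rect /= h2; lia.
  by rewrite es.
have : (c, d) \in s by rewrite es mem_head.
rewrite mem_filter mem_rect /= => h; left; exists c, d.
by case: (t c d) h; split=> //; lia.
Qed.

(** For length 1 no index lies strictly between i and j, so every letter is forced and y is inserted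
    there. For length 2 the only inner index is [i.+1], the twin of y, and just its letters with i
    and j stay open. *)
Lemma pattern_short i j : min_mid N t i j -> j - i <= 2 -> pattern N t.
Proof.
move=> mm l; case: (mm) => h1 h2 h3.
have [e|e] : j = i.+1 \/ j = i.+2 by lia.
  apply: (@PatIns _ _ i) => [|a b hab]; first lia.
  rewrite /tab_ins; case: (leqP b i) => hb; first by apply: (mm_left Pt mm); lia.
  case: (ltnP i a) => ha; first by apply: (mm_right Pt mm); lia.
  by apply: (mm_across Pt mm); lia.
have hk : i < i.+1 < j by lia.
apply: (@PatR _ _ i.+1 (t i i.+1) (t i.+1 i.+2)); try lia.
- exact: (mm_inL Pt mm hk).
- by have := mm_inR Pt mm hk; rewrite e.
move=> a b hab; rewrite /tab_R /=.
case: (a =P i.+1) => [ea|ha].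
  rewrite ea in hab *.
  case: (b =P i.+2) => [-> //|hb].
  by apply: (mm_offR Pt mm); lia.
case: (b =P i.+1) => [eb|hb].
  rewrite eb in hab *.
  case: (a =P i) => [-> //|ha'].
  by apply: (mm_offL Pt mm); lia.
case: (ltnP b i.+1) => hb'; first by apply: (mm_left Pt mm); lia.
case: (ltnP i.+1 a) => ha'; first by apply: (mm_right Pt mm); lia.
by apply: (mm_across Pt mm); lia.
Qed.

(** * Tables where y is between no two points, except perhaps the two ends *)

Section Ends.
Hypothesis midE : forall a b, a < b < N -> t a b = M -> a = 0 /\ b = N.-1.

(** L and R pass to subintervals, so an interval containing a consecutive pair that is not L and one
    that is not R can only carry M or O, and [midE] rules out M. *)
Lemma mixed_off a b k l : a <= k < b -> a <= l < b -> b < N -> b - a < N.-1 ->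
  t k k.+1 <> L -> t l l.+1 <> R -> t a b = O.
Proof.
move=> hk hl hN hb kL lR; case e: (t a b) => //.
- by case: kL; apply: (L_sub Pt _ _ _ _ e); lia.
- by case: lR; apply: (R_sub Pt _ _ _ _ e); lia.
- by case: (midE _ e); lia.
Qed.

Hypothesis offN : off N t <= 2 * N - 8.

(** An O at (k, k+1) spoils every pair around it except possibly (0, N - 1). These are (k + 1)(N - 1
    - k) - 1 >= 2N - 5 triangles. *)
Lemma inner_letter k : 1 <= k <= N - 3 -> t k k.+1 <> O.
Proof.
move=> hk e.
pose s := rem (0, N.-1) (rect 0 k.+1 k.+1 (N.-1 - k)).
have : size s <= off N t.
  apply: off_ge => [|a b]; first by rewrite rem_uniq ?uniq_rect.
  rewrite mem_rem_uniq ?uniq_rect // inE mem_rect xpair_eqE => h.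
  split; first lia.
  by apply: (@mixed_off _ _ k k); rewrite ?e //; lia.
rewrite size_rem ?size_rect ?mem_rect; last lia.
by nia.
Qed.

(** If the letters on the two sides of k differ, every pair a < k < b except possibly (0, N - 1) is
    a triangle: k(N - 1 - k) - 1 >= 2N - 7 of them. This is one more than [offN] allows. *)
Lemma inner_step k : 2 <= k <= N - 3 -> t k.-1 k = t k k.+1.
Proof.
move=> hk.
have [//|ne] : t k.-1 k = t k k.+1 \/ t k.-1 k <> t k k.+1.
  by case: (t k.-1 k); case: (t k k.+1); do [by left|by right].
have e : k.-1.+1 = k by lia.
pose s := rem (0, N.-1) (rect 0 k k.+1 (N.-1 - k)).
have : size s <= off N t.
  apply: off_ge => [|a b]; first by rewrite rem_uniq ?uniq_rect.
  rewrite mem_rem_uniq ?uniq_rect // inE mem_rect xpair_eqE => h.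
  split; first lia.
  case e1: (t k.-1 k) ne => ne; case e2: (t k k.+1) ne => // _;
    do [by apply: (@mixed_off _ _ k k); rewrite ?e2 //; lia |
        by apply: (@mixed_off _ _ k.-1 k.-1); rewrite ?e ?e1 //; lia |
        by apply: (@mixed_off _ _ k.-1 k); rewrite ?e ?e1 ?e2 //; lia |
        by apply: (@mixed_off _ _ k k.-1); rewrite ?e ?e1 ?e2 //; lia].
rewrite size_rem ?size_rect ?mem_rect; last lia.
by nia.
Qed.

Lemma inner_const k : 1 <= k <= N - 3 -> t k k.+1 = t 1 2.
Proof.
elim: k => [|k IH] // hk.
case: (ltnP k 1) => [|k1]; first by case: k {IH hk}.
by rewrite -inner_step /= ?IH //; lia.
Qed.

(** If both end letters deviated from the common inner letter, the pairs (0, b) with 2 <= b <= N - 2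
    and the pairs (a, N - 1) with 1 <= a <= N - 3 would all be triangles, 2N - 6 in number. *)
Lemma one_end : t 0 1 = t 1 2 \/ t N.-2 N.-1 = t 1 2.
Proof.
have dec l l' : l = l' :> letter \/ l <> l' by case: l; case: l'; do [by left|by right].
case: (dec (t 0 1) (t 1 2)) => [|h1]; first by left.
case: (dec (t N.-2 N.-1) (t 1 2)) => [|h2]; first by right.
have eN : N.-2.+1 = N.-1 by lia.
have e12 k : 1 <= k <= N - 3 -> t k k.+1 = t 1 2 by apply: inner_const.
have e3 : t (N - 3) N.-2 = t 1 2 by rewrite -(e12 (N - 3)); [congr t|]; lia.
have hO a b : a < b < N -> b - a < N.-1 -> a = 0 /\ 1 < b \/ b = N.-1 /\ a < N.-2 -> t a b = O.
  move=> hab hba ends; case e: (t a b) => //; last by case: (midE _ e); lia.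
  - case: ends => ends.
      case: h1; rewrite (L_sub Pt _ _ _ _ e) ?(L_sub Pt _ _ _ _ e) //; lia.
    by case: h2; rewrite -e3 (L_sub Pt _ _ _ _ e) ?(L_sub Pt _ _ _ _ e) //; lia.
  - case: ends => ends.
      case: h1; rewrite (R_sub Pt _ _ _ _ e) ?(R_sub Pt _ _ _ _ e) //; lia.
    by case: h2; rewrite -e3 (R_sub Pt _ _ _ _ e) ?(R_sub Pt _ _ _ _ e) //; lia.
pose s := rect 0 1 2 (N - 3) ++ rect 1 (N - 3) N.-1 1.
have : size s <= off N t.
  apply: off_ge => [|a b].
    rewrite cat_uniq !uniq_rect andbT /=.
    by apply/hasPn=> -[a b]; rewrite !mem_rect; lia.
  rewrite mem_cat !mem_rect => h.
  split; first lia.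
  by apply: hO; lia.
by rewrite size_cat !size_rect; lia.
Qed.
(** The two end letters decide: both L give a line with y in front, a deviation at the last pair
    gives a cycle [tab_S], a deviation at the first pair gives twins [tab_Q]. *)
Lemma pattern_L : (forall k, 1 <= k <= N - 3 -> t k k.+1 = L) ->
  t 0 1 = L \/ t N.-2 N.-1 = L -> pattern N t.
Proof.
(* Without [offN] the lemma applies to the reversed table with no need to count its triangles
   again. *)
clear offN => hL ends.
have dec l : l = L \/ l <> L by case: l; do [by left|by right].
have RO a b : a < b < N -> b - a < N.-1 -> t a b <> L -> t a b = R \/ t a b = O.
  by move=> h h'; case e: (t a b) => // _; auto; case: (midE _ e); lia.
case: (dec (t 0 1)) => h1; case: (dec (t N.-2 N.-1)) => h2; last by case: ends.
- apply: PatL => a b hab; apply: (L_run Pt) => // k hk.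
  have [->|[->|]] : k = 0 \/ k = N.-2 \/ 1 <= k <= N - 3 by lia.
  + by [].
  + by rewrite (_ : N.-2.+1 = N.-1) //; lia.
  + exact: hL.
- apply: (@PatS _ _ (t N.-2 N.-1) (t 0 N.-1)).
  + by apply: RO => //; lia.
  + case e: (t 0 N.-1); auto.
      by case: h2; apply: (L_sub Pt _ _ _ _ e); lia.
    by have : t 0 1 = R; [apply: (R_sub Pt _ _ _ _ e); lia|rewrite h1].
  move=> a b hab; rewrite /tab_S; case: ltnP => hb.
    apply: (L_run Pt) => // k hk.
    case: (posnP k) => [-> //|k0]; apply: hL; lia.
  have -> : b = N.-1 by lia.
  case: eqP => [-> //|ha]; case: eqP => [-> //|ha'].
  have eN : N.-2.+1 = N.-1 by lia.
  have ea : t a a.+1 = L by apply: hL; lia.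
  by apply: (@mixed_off _ _ N.-2 a); rewrite ?eN ?ea //; lia.
- have hL1 a b : 0 < a -> a < b < N -> t a b = L.
    move=> a0 hab; apply: (L_run Pt) => // k hk.
    have [->|] : k = N.-2 \/ 1 <= k <= N - 3 by lia.
      by rewrite (_ : N.-2.+1 = N.-1) //; lia.
    exact: hL.
  apply: (@PatQ _ _ (t 0 1)).
    by apply: RO => //; lia.
  move=> a b hab; rewrite /tab_Q; case: posnP => [->|ha].
    case: eqP => [-> //|hb].
    case e: (t 0 b) => //.
    + by case: h1; apply: (L_sub Pt _ _ _ _ e); lia.
    + by have : t 1 2 = R; [apply: (R_sub Pt _ _ _ _ e); lia|rewrite hL //; lia].
    (* M on the whole line, together with L at (1, b), would put y between 0 and 1, contrary to
       [midE]. *)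
    case: (midE _ e) => [|_ eb]; first lia.
    have : t 0 1 = M.
      apply: (@placeML _ _ Pt 0 1 b) => //; try lia.
      by apply: hL1; lia.
    by case/midE; lia.
  exact: hL1.
Qed.
End Ends.
End Pattern.

(** Reversal is called for only when the common inner letter is R, the mirror image of the case
    treated in [pattern_L]. *)
Theorem pattern_of_table N t : place_rules N t -> 4 <= N -> off N t <= 2 * N - 8 ->
  pattern N t \/ pattern N (rev_table N t).
Proof.
move=> Pt N4 offN.
have [p|midE] : pattern N t \/ forall a b, a < b < N -> t a b = M -> a = 0 /\ b = N.-1.
  case: (mid_dec t N4) => [[a [b [hab e]]]|h]; last by right=> a b /h.
  have [i [j mm]] := min_mid_exists hab e.
  case: (mm) => h1 h2 h3.
  case: (leqP (j - i) 2) => l; first by left; apply: (pattern_short Pt N4 mm).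
  case: (leqP (j - i) (N - 2)) => l'.
    have h : 3 <= j - i <= N - 2 by rewrite l.
    by have := mm_long Pt mm h; lia.
  (* Only length N - 1 remains, so the minimal pair is (0, N - 1), and its minimality is the
     claim. *)
  by right=> c d hcd /(h3 c d) []; lia.
- by left.
have inner := inner_const Pt N4 midE offN.
have ends := one_end Pt N4 midE offN.
have e12 : t 1 2 = L \/ t 1 2 = R.
  case e: (t 1 2); auto; first by case: (midE _ _ _ e); lia.
  by case: (@inner_letter _ _ Pt N4 midE offN 1); rewrite ?e //; lia.
case: e12 => e12; rewrite e12 in inner ends.
  by left; apply: pattern_L.
right; apply: pattern_L => //.
- exact: place_rev.
- move=> a b hab; rewrite /rev_table => h.
  have e : t (N.-1 - b) (N.-1 - a) = M by case: (t _ _) h.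
  have lt : N.-1 - b < N.-1 - a < N by lia.
  by case: (midE _ _ lt e); lia.
- move=> k hk; rewrite /rev_table.
  have -> : N.-1 - k = (N.-1 - k.+1).+1 by lia.
  by rewrite inner //; lia.
- have n1 : N.-1 - N.-2 = 1 by lia.
  have n2 : N.-1 - 1 = N.-2 by lia.
  rewrite /rev_table subnn n1 n2 subn0.
  by case: ends => ->; [right|left].
Qed.

(** * Number of triangles of each table *)

Lemma off_L N : off N (fun _ _ => L) = 0.
Proof.
by apply: (@off_eq _ _ [::]) => // a b; rewrite andbF.
Qed.

Lemma off_ins N k : off N (tab_ins k) = 0.
Proof.
apply: (@off_eq _ _ [::]) => // a b; rewrite /tab_ins.
by case: ifP => _; [|case: ifP => _]; rewrite andbF.
Qed.

(* All the pairs of the remaining tables that form triangles contain one index k. *)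
Lemma off_cross N k (t : nat -> nat -> letter) (s : seq nat) : uniq s ->
  (forall a, a \in s -> a < N) ->
  k \in s ->
  (forall a b, a < b < N -> isO (t a b) =
     (a == k) && (b \notin s) || (b == k) && (a \notin s)) ->
  off N t = N - size s.
Proof.
move=> us sN ks ht.
pose w := [seq a <- iota 0 N | a \notin s].
rewrite (@off_eq _ _ [seq (minn a k, maxn a k) | a <- w]).
- have := count_predC (mem s) (iota 0 N); rewrite size_map size_filter size_iota.
  have -> : count (mem s) (iota 0 N) = size s.
    rewrite -size_filter; apply/perm_size/uniq_perm => //.
      by rewrite filter_uniq ?iota_uniq.
    by move=> a; rewrite mem_filter mem_iota /=; case: (boolP (a \in s)) => //= /sN ->.
  rewrite (@eq_count _ _ (predC (mem s))) //; lia.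
- rewrite map_inj_in_uniq ?filter_uniq ?iota_uniq // => a b _ _ [].
  lia.
move=> a b; apply/mapP/idP => [[c]|].
  rewrite mem_filter mem_iota => /andP[cs cN] [-> ->].
  have ck : c != k by apply: contraNneq cs => ->.
  have kN := sN _ ks.
  have h : minn c k < maxn c k < N by lia.
  rewrite h ht //; case: (ltngtP c k) ck => // ck _; rewrite ?eqxx ?cs //.
  by rewrite orbT.
case/andP => h; rewrite ht // => /orP[] /andP[/eqP e hs]; rewrite e in h *.
  by exists b; [rewrite mem_filter mem_iota hs; lia|congr pair; lia].
by exists a; [rewrite mem_filter mem_iota hs; lia|congr pair; lia].
Qed.

Lemma off_R N k u v : 0 < k -> k.+1 < N -> u = L \/ u = O -> v = R \/ v = O ->
  off N (tab_R k u v) = N - 3 + isO u + isO v.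
Proof.
move=> k0 kN hu hv.
(* Besides k itself, [s] collects the indices whose pair with k is not a triangle; the same scheme
   serves [off_Q] and [off_S]. *)
pose s := k :: (if isO u then [::] else [:: k.-1]) ++ (if isO v then [::] else [:: k.+1]).
rewrite (@off_cross N k _ s).
- by rewrite /s; case: hu => ->; case: hv => -> /=; lia.
- by rewrite /s; case: hu => ->; case: hv => -> /=; rewrite ?inE; lia.
- by move=> a; rewrite /s; case: hu => ->; case: hv => -> /=; rewrite ?inE; lia.
- by rewrite mem_head.
move=> a b hab; rewrite /tab_R /s.
case: (a =P k) => ha.
  by case: eqP => hb; case: hu => ->; case: hv => -> /=; rewrite ?inE; lia.
case: (b =P k) => hb.
  by case: eqP => hb'; case: hu => ->; case: hv => -> /=; rewrite ?inE; lia.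
by rewrite /=; case: ifP => // _; case: ifP.
Qed.

Lemma off_Q N x : 2 <= N -> x = R \/ x = O -> off N (tab_Q x) = N - 2 + isO x.
Proof.
move=> N2 hx.
rewrite (@off_cross N 0 _ (0 :: if isO x then [::] else [:: 1])).
- by case: hx => -> /=; lia.
- by case: hx => -> /=.
- by move=> a; case: hx => -> /=; rewrite ?inE; lia.
- by rewrite mem_head.
move=> a b hab; rewrite /tab_Q; case: posnP => ha; last first.
  by rewrite /=; case: hx => -> /=; rewrite ?inE; lia.
by case: eqP => hb; case: hx => -> /=; rewrite ?inE; lia.
Qed.

Lemma off_S N x z : 3 <= N -> x = R \/ x = O -> z = M \/ z = O ->
  off N (tab_S N x z) = N - 3 + isO x + isO z.
Proof.
move=> N3 hx hz.
pose s := N.-1 :: (if isO x then [::] else [:: N.-2]) ++ (if isO z then [::] else [:: 0]).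
rewrite (@off_cross N N.-1 _ s).
- by rewrite /s; case: hx => ->; case: hz => -> /=; lia.
- by rewrite /s; case: hx => ->; case: hz => -> /=; rewrite ?inE; lia.
- by move=> a; rewrite /s; case: hx => ->; case: hz => -> /=; rewrite ?inE; lia.
- by rewrite mem_head.
move=> a b hab; rewrite /tab_S /s; case: ltnP => hb.
  by rewrite /=; case: hx => ->; case: hz => -> /=; rewrite ?inE; lia.
case: eqP => ha.
  by case: hx => ->; case: hz => -> /=; rewrite ?inE; lia.
by case: eqP => ha'; case: hx => ->; case: hz => -> /=; rewrite ?inE; lia.
Qed.

(** * Lines and triangles *)

(** By (P2) three of the six orders suffice. The predicate also forces the points to be distinct,
    since a triple with two equal neighbours is always in the relation. *)
Definition noncol (S : structure) (x y z : S) : bool :=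
  [&& ~~ btw x y z, ~~ btw y x z & ~~ btw x z y].

(** For three distinct points (P3) makes the tests mutually exclusive, so their order is
    immaterial. *)
Definition place (S : structure) (y u v : S) : letter :=
  if btw y u v then L else if btw u v y then R else if btw u y v then M else O.

Definition table (S : structure) (p : nat -> S) (y : S) (a b : nat) : letter :=
  place y (p a) (p b).

(** Only the values of [p] below N matter; a total function on [nat] spares casts when points are
    inserted or the line is reversed. *)
Definition chain (S : structure) (p : nat -> S) (N : nat) : Prop :=
  (forall i j, i < N -> j < N -> p i = p j -> i = j) /\
  (forall i j k, i < j -> j < k -> k < N -> btw (p i) (p j) (p k)).

Definition pset (S : structure) (p : nat -> S) (N : nat) : {set S} :=
  [set p (val i) | i : 'I_N].

Definition tris (S : structure) (A : {set S}) : {set {set S}} :=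
  [set T in triangles S | T \subset A].

Definition insert (S : structure) (p : nat -> S) (y : S) (m i : nat) : S :=
  if i < m then p i else if i == m then y else p i.-1.

Lemma psetP (S : structure) (p : nat -> S) N x :
  reflect (exists2 i, i < N & x = p i) (x \in pset p N).
Proof.
apply: (iffP imsetP) => [[i _ ->]|[i iN ->]]; first by exists (val i); rewrite ?ltn_ord.
by exists (Ordinal iN).
Qed.

Lemma card3_ex (T : finType) (A : {set T}) : #|A| = 3 ->
  exists x y z, [/\ A = [set x; y; z], x != y, y != z & x != z].
Proof.
move=> A3; have [x xA] : exists x, x \in A by apply/set0Pn; rewrite -card_gt0 A3.
have : #|A :\ x| == 2 by move: (cardsD1 x A); rewrite A3 xA; lia.
case/cards2P => y [z [yz e]].
have yA : y \in A :\ x by rewrite e !inE eqxx.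
have zA : z \in A :\ x by rewrite e !inE eqxx orbT.
exists x, y, z; split=> //; first by rewrite -(setD1K xA) e setUA.
- by move: yA; rewrite !inE eq_sym => /andP[].
- by move: zA; rewrite !inE eq_sym => /andP[].
Qed.

Section Betweenness.
Context (S : structure) (HS : betweenness S).
Implicit Types (x y z u v w : S) (A : {set S}) (p : nat -> S).

Lemma btw_xxz x z : btw x x z. Proof. by case: HS. Qed.
Lemma btw_sym x y z : btw x y z = btw z y x.
Proof. by case: HS => _ _ h _ _; apply/idP/idP => /h. Qed.
Lemma btw_xzz x z : btw x z z. Proof. by rewrite btw_sym btw_xxz. Qed.
Lemma btw_eql x y z : btw x y z -> btw y x z -> x = y.
Proof. by case: HS => _ _ _ h _; apply: h. Qed.
Lemma btw_eqr x y z : btw x y z -> btw x z y -> y = z.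
Proof. by rewrite btw_sym => h; rewrite btw_sym => h'; rewrite (btw_eql h h'). Qed.
Lemma btw_xyx x y : btw x y x -> x = y.
Proof. by move=> h; apply: (btw_eql h); rewrite btw_xzz. Qed.
Lemma btw_trl x y z w : btw x y z -> btw x w y -> btw x w z.
Proof. by case: HS => _ _ _ _ h /h h' /h' []. Qed.
Lemma btw_trr x y z w : btw x y z -> btw x w y -> btw w y z.
Proof. by case: HS => _ _ _ _ h /h h' /h' []. Qed.

Lemma noncolC x y z : noncol x y z = noncol y x z.
Proof.
by rewrite /noncol (btw_sym x z y) (btw_sym y z x) andbA (andbC (~~ _)) -andbA.
Qed.

Lemma noncolCr x y z : noncol x y z = noncol x z y.
Proof.
rewrite /noncol (btw_sym z x y); case: (btw x y z); case: (btw y x z); case: (btw x z y) => //.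
Qed.

Lemma noncol_neq x y z : noncol x y z -> [/\ x != y, y != z & x != z].
Proof.
move=> /and3P[h1 h2 h3]; split; apply/eqP => e; move: h1 h2 h3; rewrite ?e.
- by rewrite btw_xxz.
- by rewrite btw_xzz.
- by rewrite btw_xzz.
Qed.

Lemma triangleP (T : {set S}) :
  reflect (exists x y z, T = [set x; y; z] /\ noncol x y z) (T \in triangles S).
Proof.
apply: (iffP idP).
  rewrite inE => /andP[/eqP/card3_ex [x [y [z [-> xy yz xz]]]]].
  rewrite /collinear => /existsP h; exists x, y, z; split=> //.
  apply/and3P; split; apply/negP => h'; case: h.
  - by exists x; apply/existsP; exists y; apply/existsP; exists z; rewrite eqxx.
  - exists y; apply/existsP; exists x; apply/existsP; exists z.
    by rewrite h' (setUC [set y]) eqxx.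
  - exists x; apply/existsP; exists z; apply/existsP; exists y.
    by rewrite h' -!setUA (setUC [set y]) eqxx.
move=> [x [y [z [-> n]]]]; have [xy yz xz] := noncol_neq n.
have c3 : #|[set x; y; z]| = 3.
  by rewrite -setUA cardsU1 cards2 !inE negb_or xy xz yz.
rewrite inE c3 eqxx /=; apply/existsP => -[x' /existsP[y' /existsP [z' /andP[/eqP e]]]].
have [x'y' y'z' x'z'] : [/\ x' != y', y' != z' & x' != z'].
  move: c3; rewrite e -setUA cardsU1 cards2 !inE negb_or.
  by case: eqP => //; case: eqP => //; case: eqP.
have: x' \in [set x; y; z] by rewrite e !inE eqxx.
have: y' \in [set x; y; z] by rewrite e !inE eqxx orbT.
have: z' \in [set x; y; z] by rewrite e !inE eqxx !orbT.
case/and3P: n => n1 n2 n3; rewrite !inE -!orbA.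
case/or3P => /eqP ez; case/or3P => /eqP ey; case/or3P => /eqP ex.
all: move: x'y' y'z' x'z'; rewrite ex ey ez ?eqxx // => _ _ _; apply/negP => //.
all: by rewrite btw_sym.
Qed.

Section Place.
Context (y u v : S) (uv : u != v) (yu : y != u) (yv : y != v).

Lemma placeL : place y u v = L <-> btw y u v.
Proof. by rewrite /place; case: ifP => //; case: ifP => //; case: ifP. Qed.

Lemma placeR : place y u v = R <-> btw u v y.
Proof.
rewrite /place; case: ifP => h; last by case: ifP => //; case: ifP.
split=> // h'; case/eqP: uv; rewrite btw_sym in h'.
exact: btw_eqr h h'.
Qed.

Lemma placeM : place y u v = M <-> btw u y v.
Proof.
rewrite /place; case: ifP => h.
  by split=> // h'; case/eqP: yu; apply: btw_eql h h'.
case: ifP => h'; last by case: ifP.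
by split=> // h''; case/eqP: yv; apply: btw_eqr h'' h'.
Qed.

Lemma placeO : isO (place y u v) = noncol y u v.
Proof.
rewrite /place /noncol (btw_sym y v u).
by case: (btw y u v); case: (btw u v y); case: (btw u y v).
Qed.

Lemma place_swap : place y v u = swap (place y u v).
Proof.
have h1 := placeL; have h2 := placeR; have h3 := placeM; rewrite {1}/place.
rewrite (btw_sym y v u) (btw_sym v u y) (btw_sym v y u).
case: ifP => a; first by rewrite (proj2 h2 a).
case: ifP => b; first by rewrite (proj2 h1 b).
case: ifP => c; first by rewrite (proj2 h3 c).
by rewrite /place a b c.
Qed.
End Place.

Section Chain.
Context (p : nat -> S) (N : nat) (cp : chain p N).

Lemma chain_neq i j : i < N -> j < N -> i != j -> p i != p j.
Proof. by case: cp => inj _ iN jN; apply: contraNneq => /inj ->. Qed.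

Lemma card_pset : #|pset p N| = N.
Proof.
rewrite card_imset ?card_ord // => i j /(proj1 cp) e.
by apply/val_inj/e; rewrite ltn_ord.
Qed.

Lemma mem_pset i : i < N -> p i \in pset p N.
Proof. by move=> iN; apply/psetP; exists i. Qed.

Lemma chain_rev : chain (fun i => p (N.-1 - i)) N.
Proof.
case: cp => inj ord; split=> [i j iN jN /inj|i j k ij jk kN].
  by lia.
by rewrite btw_sym; apply: ord; lia.
Qed.

Lemma pset_rev : pset (fun i => p (N.-1 - i)) N = pset p N.
Proof.
apply/setP => x; apply/psetP/psetP => -[i iN ->]; exists (N.-1 - i); try lia.
  by [].
by congr p; lia.
Qed.

Section Extra.
Context (y : S) (yp : y \notin pset p N).

Lemma extra_neq i : i < N -> y != p i.
Proof. by move=> iN; apply: contraNneq yp => ->; apply: mem_pset. Qed.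

Lemma tableL a b : a < b < N -> table p y a b = L <-> btw y (p a) (p b).
Proof. by move=> h; apply: placeL; rewrite ?chain_neq ?extra_neq; lia. Qed.

Lemma tableR a b : a < b < N -> table p y a b = R <-> btw (p a) (p b) y.
Proof. by move=> h; apply: placeR; rewrite ?chain_neq ?extra_neq //; lia. Qed.

Lemma tableM a b : a < b < N -> table p y a b = M <-> btw (p a) y (p b).
Proof. by move=> h; apply: placeM; rewrite ?chain_neq ?extra_neq //; lia. Qed.

Lemma tableO a b : isO (table p y a b) = noncol y (p a) (p b).
Proof. exact: placeO. Qed.

Lemma place_rules_table : place_rules N (table p y).
Proof.
case: cp => _ ord.
split=> a b c ab bc cN; have bN : b < N by lia.
all: have h := ord _ _ _ ab bc cN; have h' := h; rewrite btw_sym in h'.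
all: have hab : a < b < N by rewrite ab.
all: have hbc : b < c < N by rewrite bc.
all: have hac : a < c < N by lia.
- rewrite !tableL // => e; rewrite btw_sym in e.
  by rewrite btw_sym (btw_trr e h') btw_sym (btw_trl e h').
- by rewrite !tableL // => e e'; apply: btw_trl e' e.
- by rewrite !tableR // => e; rewrite (btw_trl e h) (btw_trr e h).
- rewrite !tableR // => e e'; rewrite btw_sym in e; rewrite btw_sym in e'.
  by rewrite btw_sym (btw_trl e e').
- by rewrite !tableM // tableL // => e; rewrite (btw_trl h e) (btw_trr h e).
- rewrite !tableM // tableR // => e; rewrite btw_sym in e.
  by rewrite btw_sym (btw_trl h' e) btw_sym (btw_trr h' e).
- by rewrite !tableM // tableR // => e e'; rewrite (btw_trr e e').
- rewrite !tableM // tableL // => e e'; rewrite btw_sym in e; rewrite btw_sym in e'.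
  by rewrite btw_sym (btw_trr e e').
Qed.

Lemma table_rev : same_table N (table (fun i => p (N.-1 - i)) y) (rev_table N (table p y)).
Proof.
move=> a b hab; rewrite /table /rev_table.
by rewrite (@place_swap _ (p (N.-1 - b))) ?chain_neq ?extra_neq //; lia.
Qed.

Lemma insertE_lt m i : i < m -> insert p y m i = p i.
Proof. by rewrite /insert => ->. Qed.

Lemma insertE_eq m : insert p y m m = y.
Proof. by rewrite /insert ltnn eqxx. Qed.

Lemma insertE_gt m i : m < i -> insert p y m i = p i.-1.
Proof. by rewrite /insert => h; rewrite ltnNge (ltnW h) /= gtn_eqF. Qed.

Lemma pset_insert m : m <= N -> pset (insert p y m) N.+1 = y |: pset p N.
Proof.
move=> mN; apply/setP => x; rewrite inE in_set1; apply/psetP/orP.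
  case=> i iN ->; case: (ltngtP i m) => h; last by left; rewrite h insertE_eq.
    by right; rewrite insertE_lt // mem_pset //; lia.
  by right; rewrite insertE_gt // mem_pset //; lia.
case=> [/eqP ->|/psetP [i iN ->]]; first by exists m; rewrite ?insertE_eq.
case: (ltnP i m) => h; first by exists i; rewrite ?insertE_lt //; lia.
by exists i.+1; rewrite ?insertE_gt.
Qed.

Lemma chain_insert m : m <= N ->
  (forall a b, a < b < N -> table p y a b = if b < m then R else if m <= a then L else M) ->
  chain (insert p y m) N.+1.
Proof.
move=> mN ht; case: (cp) => inj ord; split=> [i j iN jN|i j k ij jk kN].
  have inj' a b (e : p a = p b) (h1 : a < N) (h2 : b < N) := inj a b h1 h2 e.
  case: (ltngtP i m) => hi; case: (ltngtP j m) => hj; rewrite ?hi ?hj //;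
    rewrite ?insertE_eq ?(insertE_lt hi) ?(insertE_lt hj) ?(insertE_gt hi) ?(insertE_gt hj).
  - by move=> e; suff: i = j; [lia|apply: (inj' _ _ e); lia].
  - by move=> e; suff: i = j.-1; [lia|apply: (inj' _ _ e); lia].
  - by move/eqP; rewrite eq_sym (negbTE (extra_neq _)) //; lia.
  - by move=> e; suff: i.-1 = j; [lia|apply: (inj' _ _ e); lia].
  - by move=> e; suff: i.-1 = j.-1; [lia|apply: (inj' _ _ e); lia].
  - by move/eqP; rewrite eq_sym (negbTE (extra_neq _)) //; lia.
  - by move/eqP; rewrite (negbTE (extra_neq _)) //; lia.
  - by move/eqP; rewrite (negbTE (extra_neq _)) //; lia.
case: (ltngtP j m) => hj.
- rewrite (@insertE_lt _ i) ?(insertE_lt hj); last lia.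
  case: (ltngtP k m) => hk.
  + by rewrite insertE_lt //; apply: ord; lia.
  + by rewrite insertE_gt //; apply: ord; lia.
  rewrite hk insertE_eq.
  have h : i < j < N by lia.
  by apply/(tableR h); rewrite ht ?hj.
- rewrite (insertE_gt hj) (@insertE_gt _ k); last lia.
  case: (ltngtP i m) => hi.
  + by rewrite insertE_lt //; apply: ord; lia.
  + by rewrite insertE_gt //; apply: ord; lia.
  rewrite hi insertE_eq.
  have h : j.-1 < k.-1 < N by lia.
  by apply/(tableL h); rewrite ht // ifF ?ifT //; lia.
rewrite hj insertE_eq insertE_lt ?insertE_gt; try lia.
have h : i < k.-1 < N by lia.
by apply/(tableM h); rewrite ht // !ifF //; lia.
Qed.

End Extra.
End Chain.
End Betweenness.

(** * Triangles of a line and one more point *)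

Section Counting.
Context (S : structure) (HS : betweenness S).
Implicit Types (x y z u v w : S) (A : {set S}) (p : nat -> S).

Lemma trisP A (T : {set S}) :
  reflect (exists x y z, [/\ T = [set x; y; z], [&& x \in A, y \in A & z \in A] & noncol x y z])
    (T \in tris A).
Proof.
rewrite inE; apply: (iffP andP).
  case=> /(triangleP HS) [x [y [z [-> n]]]] /subsetP h; exists x, y, z; split=> //.
  by rewrite !h // !inE eqxx ?orbT.
case=> x [y [z [-> /and3P[xA yA zA] n]]]; split; first by apply/(triangleP HS); exists x, y, z.
by apply/subsetP => a; rewrite !inE -orbA => /or3P[] /eqP ->.
Qed.

Lemma tris_sub A (B : {set S}) : A \subset B -> tris A \subset tris B.
Proof.
move=> AB; apply/subsetP => T; rewrite !inE => /andP[-> h] /=.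
exact: subset_trans h AB.
Qed.

Lemma tris_noncol A x y z : #|tris A| = 0 -> x \in A -> y \in A -> z \in A -> noncol x y z = false.
Proof.
move=> /eqP; rewrite cards_eq0 => /eqP t0 xA yA zA; apply/negP => n.
suff: [set x; y; z] \in tris A by rewrite t0 inE.
by apply/trisP; exists x, y, z; split=> //; rewrite xA yA.
Qed.

Lemma tris_chain p N : chain p N -> #|tris (pset p N)| = 0.
Proof.
move=> cp; apply/eqP; rewrite cards_eq0 -subset0; apply/subsetP => T.
case/trisP => x [y [z [_ /and3P[]]]].
move=> /psetP[i iN ->] /psetP [j jN ->] /psetP [k kN ->] n.
have [/eqP ij /eqP jk /eqP ik] := noncol_neq HS n.
have ord a b c : a < N -> b < N -> c < N -> a < b < c -> btw (p a) (p b) (p c).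
  by move=> *; apply: (proj2 cp); lia.
have {}ij : i <> j by move=> e; rewrite e in ij.
have {}jk : j <> k by move=> e; rewrite e in jk.
have {}ik : i <> k by move=> e; rewrite e in ik.
have [h|[h|[h|[h|[h|h]]]]] : i < j < k \/ k < j < i \/ j < i < k \/ k < i < j \/
    i < k < j \/ j < k < i by lia.
all: case/and3P: n => n1 n2 n3.
- by rewrite ord in n1.
- by rewrite btw_sym // ord in n1.
- by rewrite ord in n2.
- by rewrite btw_sym // ord in n2.
- by rewrite ord in n3.
- by rewrite btw_sym // ord in n3.
Qed.

(** The line has no triangle, so each triangle contains y and is determined by the unique pair of
    indices a < b of its other two points. *)
Lemma tris_off p N y : chain p N -> y \notin pset p N ->
  #|tris (y |: pset p N)| = off N (table p y).
Proof.
move=> cp yp.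
pose f (e : nat * nat) := [set y; p e.1; p e.2].
have inj : {in off_pairs N (table p y) &, injective f}.
  move=> [a b] [c d]; rewrite !off_pairsP /f /= => /andP[h1 _] /andP[h2 _] e.
  have mem i : i < N -> (p i \in [set y; p a; p b]) = (i == a) || (i == b).
    move=> iN; rewrite !inE eq_sym (negbTE (extra_neq yp iN)) /=.
    have E j : j < N -> (p i == p j) = (i == j).
      by move=> jN; apply/eqP/eqP => [/(proj1 cp)->|->].
    by rewrite !E //; lia.
  have mem' i : i < N -> (p i \in [set y; p c; p d]) = (i == c) || (i == d).
    move=> iN; rewrite !inE eq_sym (negbTE (extra_neq yp iN)) /=.
    have E j : j < N -> (p i == p j) = (i == j).
      by move=> jN; apply/eqP/eqP => [/(proj1 cp)->|->].
    by rewrite !E //; lia.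
  have M i : i < N -> (i == a) || (i == b) = (i == c) || (i == d).
    by move=> iN; rewrite -mem // e mem'.
  have := M a; have := M b; have := M c; have := M d; rewrite !eqxx ?orbT /=.
  by move=> m1 m2 m3 m4; congr pair; lia.
have us : uniq (map f (off_pairs N (table p y))).
  by rewrite map_inj_in_uniq ?uniq_off_pairs.
rewrite /off -(size_map f) -(card_uniqP us); apply: eq_card => T.
have key u v : u \in pset p N -> v \in pset p N -> noncol y u v ->
    exists2 e, e \in off_pairs N (table p y) & [set y; u; v] = f e.
  move=> /psetP [i iN ->] /psetP [j jN ->] n.
  have [_ /eqP ij _] := noncol_neq HS n.
  case: (ltngtP i j) => [lt|lt|e]; last by rewrite e in ij.
    by exists (i, j) => //; rewrite off_pairsP lt jN tableO.
  exists (j, i); first by rewrite off_pairsP lt iN tableO // noncolCr.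
  by rewrite /f /= -!setUA (setUC [set p i]).
apply/trisP/mapP => [[x [u [v [-> /and3P[xA uA vA] n]]]]|[[a b] + ->]].
  case/setU1P: xA n => [->|xA] n.
    have [yu uv yv] := noncol_neq HS n.
    case/setU1P: uA => [e|uA]; first by rewrite e eqxx in yu.
    case/setU1P: vA => [e|vA]; first by rewrite e eqxx in yv.
    exact: key.
  case/setU1P: uA n => [->|uA] n.
    rewrite noncolC // in n; have [yu uv yv] := noncol_neq HS n.
    case/setU1P: vA => [e|vA]; first by rewrite e eqxx in yv.
    by rewrite (setUC [set x]); apply: key.
  case/setU1P: vA n => [->|vA] n.
    rewrite noncolCr // noncolC // in n.
    by have [e ?] := key _ _ xA uA n; exists e; rewrite // setUC setUA.
  by rewrite (tris_noncol (tris_chain cp)) in n.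
rewrite off_pairsP => /andP[h]; rewrite tableO // => n.
exists y, (p a), (p b); split=> //.
by rewrite !inE eqxx !mem_pset ?orbT //; lia.
Qed.

(** The gap between 0 and N - 3: a pattern either is the table of a point inserted at some place m,
    or has at least N - 3 entries O. *)
Lemma off_pattern N t : 3 <= N -> pattern N t ->
  [\/ off N t = 0 /\ exists2 m, m <= N &
       (forall a b, a < b < N -> t a b = if b < m then R else if m <= a then L else M)
    | N - 3 <= off N t].
Proof.
move=> N3 [h|k kN h|k u v k0 kN hu hv h|x hx h|x z hx hz h]; rewrite (off_same h).
- by left; rewrite off_L; split=> //; exists 0 => // a b /h.
- by left; rewrite off_ins; split=> //; exists k.+1; [lia|move=> a b /h].
- by right; rewrite off_R //; lia.
- by right; rewrite off_Q //; lia.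
- by right; rewrite off_S //; lia.
Qed.

Lemma chain_pattern p N y : chain p N -> y \notin pset p N -> 4 <= N ->
  #|tris (y |: pset p N)| <= 2 * N - 8 ->
  exists q, [/\ chain q N, pset q N = pset p N & pattern N (table q y)].
Proof.
move=> cp yp N4; rewrite tris_off // => h.
case: (pattern_of_table (place_rules_table HS cp yp) N4 h) => pt; first by exists p.
exists (fun i => p (N.-1 - i)); split; [exact: chain_rev|exact: pset_rev|].
have st := table_rev HS cp yp.
have tr t t' : same_table N t t' -> pattern N t' -> pattern N t.
  move=> e; case => [h'|k kN h'|k u v k0 kN hu hv h'|x hx h'|x z hx hz h'].
  - by apply: PatL => a b hab; rewrite e // h'.
  - by apply: (@PatIns _ _ k) => // a b hab; rewrite e // h'.
  - by apply: (@PatR _ _ k u v) => // a b hab; rewrite e // h'.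
  - by apply: (@PatQ _ _ x) => // a b hab; rewrite e // h'.
  - by apply: (@PatS _ _ x z) => // a b hab; rewrite e // h'.
exact: tr st pt.
Qed.

(** Below the range of the patterns this is their gap; beyond it there are at least 2N - 7 >= N - 3
    triangles anyway. *)
Lemma tris_lower p N y : chain p N -> y \notin pset p N -> 4 <= N ->
  0 < #|tris (y |: pset p N)| -> N - 3 <= #|tris (y |: pset p N)|.
Proof.
move=> cp yp N4 pos.
case: (leqP #|tris (y |: pset p N)| (2 * N - 8)) => h; last lia.
have [q [cq e pt]] := chain_pattern cp yp N4 h.
rewrite -e in yp *; rewrite tris_off //; rewrite -e tris_off // in pos.
by case: (off_pattern _ pt) => [|[]|] //; lia.
Qed.

Lemma chain_extend p N y : chain p N -> y \notin pset p N -> 4 <= N ->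
  #|tris (y |: pset p N)| = 0 -> exists2 q, chain q N.+1 & pset q N.+1 = y |: pset p N.
Proof.
move=> cp yp N4 h.
have h' : #|tris (y |: pset p N)| <= 2 * N - 8 by rewrite h.
have [q [cq e pt]] := chain_pattern cp yp N4 h'.
rewrite -e in yp *; rewrite -e tris_off // in h.
case: (off_pattern _ pt) => [|[_ [m mN ht]]|]; try lia.
by exists (insert q y m); [apply: chain_insert|apply: pset_insert].
Qed.

(** The exception is the 4-cycle through [p 0], [p 1], [p 2] and y: it is linear without being a
    line. *)
Lemma four_chain p y : chain p 3 -> y \notin pset p 3 -> #|tris (y |: pset p 3)| = 0 ->
  (exists2 q, chain q 4 & pset q 4 = y |: pset p 3) \/
  [/\ btw y (p 0) (p 1), btw (p 1) (p 2) y & btw (p 0) y (p 2)].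
Proof.
move=> cp yp; rewrite tris_off // => off0.
have Pt := place_rules_table HS cp yp.
have nO a b : a < b < 3 -> table p y a b <> O.
  move=> hab e; have := @off_ge 3 (table p y) [:: (a, b)] isT.
  rewrite off0 => h; suff: 1 <= 0 by [].
  by apply: h => c d; rewrite inE => /eqP [-> ->].
have ins m : m <= 3 -> (forall a b, a < b < 3 ->
     table p y a b = if b < m then R else if m <= a then L else M) ->
   exists2 q, chain q 4 & pset q 4 = y |: pset p 3.
  by move=> m3 ht; exists (insert p y m); [apply: chain_insert|apply: pset_insert].
have tab (x01 x12 x02 : letter) m : m <= 3 ->
    table p y 0 1 = x01 -> table p y 1 2 = x12 -> table p y 0 2 = x02 ->
    [/\ x01 = (if 1 < m then R else if m <= 0 then L else M),
        x12 = (if 2 < m then R else if m <= 1 then L else M)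
      & x02 = (if 2 < m then R else if m <= 0 then L else M)] ->
   exists2 q, chain q 4 & pset q 4 = y |: pset p 3.
  move=> m3 e01 e12 e02 [h1 h2 h3]; apply: (ins m m3) => a b hab.
  have [[-> ->]|[[-> ->]|[-> ->]]] : (a = 0 /\ b = 1) \/ (a = 1 /\ b = 2) \/ (a = 0 /\ b = 2) by lia.
  - by rewrite e01.
  - by rewrite e12.
  - by rewrite e02.
case e02: (table p y 0 2); last by case: (nO 0 2).
- have [e01 e12] := placeLs Pt (isT : 0 < 1) (isT : 1 < 2) isT e02.
  by left; apply: (tab _ _ _ 0 isT e01 e12 e02).
- have [e01 e12] := placeRs Pt (isT : 0 < 1) (isT : 1 < 2) isT e02.
  by left; apply: (tab _ _ _ 3 isT e01 e12 e02).
case e01: (table p y 0 1); last by case: (nO 0 1).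
- case e12: (table p y 1 2); last by case: (nO 1 2).
  + by have := placeML Pt (isT : 0 < 1) (isT : 1 < 2) isT e02 e12; rewrite e01.
  + right; split; first exact: (proj1 (@tableL _ p 3 y 0 1 isT) e01).
      exact: (proj1 (@tableR _ HS p 3 cp y yp 1 2 isT) e12).
    exact: (proj1 (@tableM _ HS p 3 y yp 0 2 isT) e02).
  + by have [] := placeMr Pt (isT : 0 < 1) (isT : 1 < 2) isT e12; rewrite e01.
- have e12 := placeRM Pt (isT : 0 < 1) (isT : 1 < 2) isT e02 e01.
  by left; apply: (tab _ _ _ 2 isT e01 e12 e02).
- have [_ e12] := placeMl Pt (isT : 0 < 1) (isT : 1 < 2) isT e01.
  by left; apply: (tab _ _ _ 1 isT e01 e12 e02).
Qed.
End Counting.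

(** * Linear structures are lines; deleting a point to reach one *)

Section Linear.
Context (S : structure) (HS : betweenness S).
Implicit Types (x y z u v w : S) (A : {set S}) (p : nat -> S).

Lemma chain3 x y z : x != y -> y != z -> x != z -> btw x y z ->
  chain (nth x [:: x; y; z]) 3.
Proof.
move=> xy yz xz b; split=> [i j i3 j3 /eqP|i j k ij jk k3].
  by rewrite nth_uniq //= ?inE ?negb_or ?xy ?xz ?yz // => /eqP.
have -> : i = 0 by lia.
have -> : j = 1 by lia.
by have -> : k = 2 by lia.
Qed.

Lemma pset3 x y z : pset (nth x [:: x; y; z]) 3 = [set x; y; z].
Proof.
apply/setP => a; rewrite !inE -orbA; apply/psetP/or3P => [[[|[|[|i]]]] // _ ->|].
- by apply: Or31; rewrite eqxx.
- by apply: Or32; rewrite eqxx.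
- by apply: Or33; rewrite eqxx.
by case=> /eqP ->; [exists 0|exists 1|exists 2].
Qed.

Lemma chain_grow p N A : chain p N -> 4 <= N -> pset p N \subset A -> #|tris A| = 0 ->
  exists2 q, chain q #|A| & pset q #|A| = A.
Proof.
move=> + + + A0; have [m] := ubnP (#|A| - N); elim: m p N => // m IH p N hm cp N4 pA.
case: (eqVneq (pset p N) A) => [e|ne].
  by have := card_pset cp; rewrite e => ->; exists p.
have /properP[_ [y yA yp]] : pset p N \proper A by rewrite properEneq ne.
have sub : y |: pset p N \subset A by rewrite subUset sub1set yA.
have t0 : #|tris (y |: pset p N)| = 0.
  by have := subset_leq_card (tris_sub sub); rewrite A0 leqn0 => /eqP.
have [q cq e] := chain_extend HS cp yp N4 t0.
apply: (IH q N.+1) => //; rewrite ?e //; last by apply: leq_trans N4 _.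
have := subset_leq_card sub; rewrite -e card_pset //.
by move: hm N4; lia.
Qed.

(** Five points leave no room for the 4-cycle exception everywhere, so some four of them form a line
    from which [chain_grow] can start. *)
Lemma four_chain_exists A : 5 <= #|A| -> #|tris A| = 0 ->
  exists2 q, chain q 4 & pset q 4 \subset A.
Proof.
move=> /card_geqP [s [us ss sA]] A0.
case: s => [|a [|b [|c [|d [|e []]]]]] // in us ss sA *.
have [xA xb] : [/\ a \in A, b \in A, c \in A, d \in A & e \in A]
   /\ uniq [:: a; b; c; d; e] by split=> //; split; apply: sA; rewrite !inE eqxx ?orbT.
case: xA => aA bA cA dA eA {us ss sA}.
wlog abc : a b c aA bA cA xb / btw a b c.
  move=> W; have := tris_noncol HS A0 aA bA cA; rewrite /noncol => /negbT.
  rewrite !negb_and !negbK => /or3P[] h.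
  - by apply: (W a b c).
  - apply: (W b a c) => //.
    by rewrite (@perm_uniq _ _ [:: a; b; c; d; e]) //; apply/permP => P /=; rewrite addnCA.
  - apply: (W a c b) => //.
    by rewrite (@perm_uniq _ _ [:: a; b; c; d; e]) //; apply/permP => P /=; congr (_ + _); rewrite addnCA.
have [ab bc ac] : [/\ a != b, b != c & a != c].
  by move: xb; rewrite /= !inE !negb_or => /and5P[/and4P[-> -> _ _] /and3P[-> _ _]].
have [da db dc] : [/\ d != a, d != b & d != c].
  by move: xb; rewrite /= !inE !negb_or !(eq_sym d) => /and5P[/and4P[_ _ -> _] /and3P[_ -> _] /andP[->]].
have [ea eb ec] : [/\ e != a, e != b & e != c].
  by move: xb; rewrite /= !inE !negb_or !(eq_sym e) => /and5P[/and4P[_ _ _ ->] /and3P[_ _ ->] /andP[_ ->]].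
have ed : e != d by move: xb; rewrite /= !inE (eq_sym e) => /and5P[_ _ _ ->].
have step x y z w : x \in A -> y \in A -> z \in A -> w \in A ->
    x != y -> y != z -> x != z -> w != x -> w != y -> w != z -> btw x y z ->
    (exists2 q, chain q 4 & pset q 4 \subset A) \/
    [/\ btw w x y, btw y z w & btw x w z].
  move=> xA yA zA wA xy yz xz wx wy wz bxyz.
  have cp := chain3 xy yz xz bxyz.
  have wp : w \notin pset (nth x [:: x; y; z]) 3.
    by rewrite pset3 !inE !negb_or wx wy wz.
  have sub : w |: pset (nth x [:: x; y; z]) 3 \subset A.
    by rewrite pset3; apply/subsetP => t; rewrite !inE -!orbA => /or4P[] /eqP ->.
  have t0 : #|tris (w |: pset (nth x [:: x; y; z]) 3)| = 0.
    by have := subset_leq_card (tris_sub sub); rewrite A0 leqn0 => /eqP.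
  case: (four_chain HS cp wp t0) => [[q cq e']|]; last by right.
  by left; exists q; rewrite ?e'.
case: (step a b c d) => // -[dab bcd adc].
case: (step a b c e) => // -[eab bce aec].
(* Now d and e both close a 4-cycle with a, b, c. Applied to the triple d, a, b, a further 4-cycle
   through e would give (a b e), against (e a b). *)
case: (step d a b e) => //; rewrite 1?eq_sym //.
case=> _ abe _; case/eqP: ab; apply: (btw_eqr HS eab).
by rewrite btw_sym.
Qed.

Lemma linear_chain A : 5 <= #|A| -> #|tris A| = 0 ->
  exists2 p, chain p #|A| & pset p #|A| = A.
Proof.
move=> A5 A0; have [q cq qA] := four_chain_exists A5 A0.
exact: (chain_grow cq).
Qed.

Lemma tris_point A x : #|tris A| = #|tris (A :\ x)| + #|[set T in tris A | x \in T]|.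
Proof.
have -> : tris (A :\ x) = tris A :\: [set T : {set S} | x \in T].
  by apply/setP => T; rewrite !inE subsetD1; case: (x \in T); rewrite ?andbF ?andbT.
have -> : [set T in tris A | x \in T] = tris A :&: [set T : {set S} | x \in T].
  by apply/setP => T; rewrite !inE.
by rewrite addnC cardsID.
Qed.

Lemma sum_tris_point A : \sum_(x in A) #|[set T in tris A | x \in T]| = 3 * #|tris A|.
Proof.
have -> : \sum_(x in A) #|[set T in tris A | x \in T]| =
    \sum_(x in A) \sum_(T in tris A) (x \in T).
  apply: eq_bigr => x _; rewrite -sum1_card big_mkcond /=.
  rewrite [RHS]big_mkcond /=; apply: eq_bigr => T _.
  by rewrite !inE; case: (x \in T); rewrite ?andbF ?andbT //= if_same.
rewrite exchange_big /= mulnC -sum_nat_const; apply: eq_bigr => T.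
rewrite !inE => /andP[/andP[/eqP T3 _] /subsetP TA].
rewrite -[RHS]T3 -sum1_card big_mkcond [RHS]big_mkcond /=; apply: eq_bigr => x _.
by case: (boolP (x \in T)) => [/TA ->|]; case: (x \in A).
Qed.

(* If A minus x and y is linear while neither A minus x nor A minus y is, these two sets
   have at least |A| - 5 triangles each, and no triangle in common. *)
Lemma linear_deletion A : 0 < #|tris A| -> #|tris A| + 11 <= 2 * #|A| ->
  exists2 y, y \in A & #|tris (A :\ y)| = 0.
Proof.
have [m] := ubnP #|A|; elim: m A => // m IH A hm pos le.
have lower (B : {set S}) y : y \notin B -> 5 <= #|B| -> #|tris B| = 0 -> 0 < #|tris (y |: B)| ->
    #|B| <= #|tris (y |: B)| + 3.
  move=> yB B5 B0 h; have [p cp e] := linear_chain B5 B0.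
  have := @tris_lower _ HS p #|B| y cp; rewrite e => /(_ yB (ltnW B5) h).
  by rewrite leq_subLR addnC.
have cardD x : x \in A -> #|A :\ x| = #|A|.-1.
  by move=> xA; rewrite (cardsD1 x A) xA.
have [T TA] : exists T, T \in tris A by apply/card_gt0P.
have pt x : x \in T -> 0 < #|[set T in tris A | x \in T]|.
  by move=> xT; apply/card_gt0P; exists T; rewrite inE TA.
have TA' : T \subset A by move: TA; rewrite inE => /andP[].
case: (pickP [pred x | (x \in A) && (#|tris (A :\ x)| == 0)]) => [x /= /andP[xA /eqP e]|no].
  by exists x.
have {no} no x : x \in A -> 0 < #|tris (A :\ x)|.
  by move=> xA; have /negbT := no x; rewrite /= xA lt0n.
(* Deleting a point lowers 2|A| by two, so the induction hypothesis applies as soon as the deleted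
   point lies in at least two triangles. *)
case: (pickP [pred x | (x \in A) && (1 < #|[set T in tris A | x \in T]|)]) => [x /= /andP[xA x2]|one].
  have split_x := tris_point A x.
  have [y yA y0] : exists2 y, y \in A :\ x & #|tris (A :\ x :\ y)| = 0.
    apply: IH; rewrite ?no ?cardD //; move: hm le x2 (no x xA) split_x;
      move: #|A| #|tris A| #|tris (A :\ x)| #|[set T in tris A | x \in T]|; lia.
  have yx : y != x by move: yA; rewrite !inE => /andP[].
  have yA' : y \in A by move: yA; rewrite !inE => /andP[].
  set B := A :\ x :\ y in y0.
  have cB : #|B| = #|A| - 2.
    have := cardsD1 y (A :\ x); rewrite yA cardD // -/B.
    by move: #|A| #|B|; lia.
  have ex : A :\ x = y |: B by rewrite setD1K.
  have eB : B = A :\ y :\ x by rewrite /B !setDDl setUC.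
  have ey : A :\ y = x |: B.
    by rewrite eB setD1K // !inE eq_sym yx.
  have B5 : 5 <= #|B|.
    rewrite cB; move: hm le x2 (no x xA) split_x;
      move: #|A| #|tris A| #|tris (A :\ x)| #|[set T in tris A | x \in T]|; lia.
  have lx : #|B| <= #|tris (A :\ x)| + 3.
    by rewrite ex; apply: lower; rewrite -?ex ?no // !inE eqxx.
  have ly : #|B| <= #|tris (A :\ y)| + 3.
    by rewrite ey; apply: lower; rewrite -?ey ?no // !inE eqxx andbF.
  have disj : tris (A :\ y) \subset [set T in tris A | x \in T].
    apply/subsetP => U; rewrite !inE => /andP[tU UA].
    rewrite tU (subset_trans UA (subsetDl _ _)) /=.
    apply: contraT => xU; have : U \in tris B by rewrite eB !inE tU subsetD1 UA.
    by move/eqP: y0; rewrite cards_eq0 => /eqP ->; rewrite inE.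
  have := subset_leq_card disj; move: lx ly split_x le B5; rewrite cB.
  move: #|A| #|tris A| #|tris (A :\ x)| #|tris (A :\ y)| #|[set T in tris A | x \in T]|; lia.
have {}one x : x \in A -> #|[set T in tris A | x \in T]| <= 1.
  by move=> xA; have /negbT := one x; rewrite /= xA /= -leqNgt.
(* Triangles are now pairwise disjoint, so there are few of them: this gives the slack to delete a
   point of a single triangle, and finally contradicts the lower bound for the triangles of
   [A :\ x]. *)
have le3 : 3 * #|tris A| <= #|A|.
  rewrite -sum_tris_point -[X in _ <= X]sum1_card; apply: leq_sum => x xA; exact: one.
have [x xT] : exists x, x \in T.
  by case/(trisP HS): TA => x [y [z [-> _ _]]]; exists x; rewrite !inE eqxx.
have xA : x \in A by apply: (subsetP TA').
have split_x := tris_point A x.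
have := no x xA; have := one x xA; have := pt x xT => p1 p2 p3.
have [y yA y0] : exists2 y, y \in A :\ x & #|tris (A :\ x :\ y)| = 0.
  apply: IH; rewrite ?no ?cardD //; move: hm le le3 p1 p2 p3 split_x;
    move: #|A| #|tris A| #|tris (A :\ x)| #|[set T in tris A | x \in T]|; lia.
set B := A :\ x :\ y in y0.
have cB : #|B| = #|A| - 2.
  have := cardsD1 y (A :\ x); rewrite yA cardD // -/B.
  by move: #|A| #|B|; lia.
have ex : A :\ x = y |: B by rewrite setD1K.
have B5 : 5 <= #|B|.
  rewrite cB; move: hm le le3 p1 p2 p3 split_x;
    move: #|A| #|tris A| #|tris (A :\ x)| #|[set T in tris A | x \in T]|; lia.
have : #|B| <= #|tris (A :\ x)| + 3.
  by rewrite ex; apply: lower; rewrite -?ex ?no // !inE eqxx.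
move: hm le le3 p1 p2 p3 split_x B5; rewrite cB;
  move: #|A| #|tris A| #|tris (A :\ x)| #|[set T in tris A | x \in T]|; lia.
Qed.
End Linear.

(** * Structures presented by a line, one more point and a table *)

Definition frame (S : structure) (N : nat) (t : nat -> nat -> letter) : Prop :=
  exists p y, [/\ chain p N, y \notin pset p N, #|S| = N.+1 & same_table N (@table S p y) t].

Definition isL (l : letter) : bool := if l is L then true else false.
Definition isR (l : letter) : bool := if l is R then true else false.
Definition isM (l : letter) : bool := if l is M then true else false.

(* The betweenness of a framed structure, the extra point having index N. *)
Definition frame_btw (N : nat) (t : nat -> nat -> letter) (i j k : nat) : bool :=
  [|| i == j, j == k |
   (i != k) &&
   if i == N then (if j < k then isL (t j k) else isR (t k j))
   else if j == N then (if i < k then isM (t i k) else isM (t k i))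
   else if k == N then (if i < j then isR (t i j) else isL (t j i))
   else (i < j < k) || (k < j < i)].

Section Frame.
Context (S : structure) (HS : betweenness S) (N : nat) (t : nat -> nat -> letter).

Lemma frame_enum : frame S N t ->
  exists2 q : nat -> S, (forall x, exists2 i, i <= N & x = q i) &
    (forall i j, i <= N -> j <= N -> q i = q j -> i = j) /\
    (forall i j k, i <= N -> j <= N -> k <= N -> btw (q i) (q j) (q k) = frame_btw N t i j k).
Proof.
case=> p [y [cp yp cS st]].
pose q i := if i < N then p i else y.
have qlt i : i < N -> q i = p i by rewrite /q => ->.
have qN : q N = y by rewrite /q ltnn.
have inj i j : i <= N -> j <= N -> q i = q j -> i = j.
  rewrite leq_eqVlt => /orP[/eqP ->|iN]; rewrite leq_eqVlt => /orP[/eqP ->|jN]; rewrite ?qN ?qlt //.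
  - by move/eqP; rewrite (negbTE (extra_neq yp jN)).
  - by move/eqP; rewrite eq_sym (negbTE (extra_neq yp iN)).
  - exact: (proj1 cp).
exists q.
  have /setP e : y |: pset p N = [set: S].
    by apply/eqP; rewrite eqEcard subsetT cardsT cS cardsU1 yp card_pset // add1n leqnn.
  move=> x; have := e x; rewrite !inE => /orP[/eqP ->|/psetP [i iN ->]].
    by exists N; rewrite ?qN.
  by exists i; rewrite ?qlt // ltnW.
split=> // i j k iN jN kN.
have tL a b : a < b < N -> btw y (p a) (p b) = isL (t a b).
  move=> h; rewrite -st //; have := @tableL _ p N y a b h.
  by case: (table p y a b) => -[]; case: (btw _ _ _) => //= h1 h2; do [by have := h2 isT | by have := h1 erefl].
have tR a b : a < b < N -> btw (p a) (p b) y = isR (t a b).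
  move=> h; rewrite -st //; have := @tableR _ HS p N cp y yp a b h.
  by case: (table p y a b) => -[]; case: (btw _ _ _) => //= h1 h2; do [by have := h2 isT | by have := h1 erefl].
have tM a b : a < b < N -> btw (p a) y (p b) = isM (t a b).
  move=> h; rewrite -st //; have := @tableM _ HS p N y yp a b h.
  by case: (table p y a b) => -[]; case: (btw _ _ _) => //= h1 h2; do [by have := h2 isT | by have := h1 erefl].
rewrite /frame_btw.
case: (eqVneq i j) => [->|ij]; first by rewrite btw_xxz.
case: (eqVneq j k) => [->|jk]; first by rewrite btw_xzz.
case: (eqVneq i k) => [ik|ik] /=.
  apply/negP; rewrite -ik => /(btw_xyx HS) e; case/eqP: ij; exact: inj.
case: eqP => [e|iN'].
  rewrite e qN !qlt; try lia.
  case: ltngtP jk => // h _; first by rewrite tL //; lia.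
  by rewrite btw_sym // tR //; lia.
case: eqP => [e|jN'].
  rewrite e qN !qlt; try lia.
  case: ltngtP ik => // h _; first by rewrite tM //; lia.
  by rewrite btw_sym // tM //; lia.
case: eqP => [e|kN'].
  rewrite e qN !qlt; try lia.
  case: ltngtP ij => // h _; first by rewrite tR //; lia.
  by rewrite btw_sym // tL //; lia.
rewrite !qlt; try lia.
have ord a b c : a < b < c -> c < N -> btw (p a) (p b) (p c).
  by move=> h h'; apply: (proj2 cp); lia.
have nord a b c : a < b < c -> c < N -> btw (p b) (p a) (p c) = false.
  move=> h h'; apply/negP => b'; have := btw_eql HS (ord _ _ _ h h') b'.
  by move/(proj1 cp) => h''; suff: a = b; [lia|apply: h''; lia].
have nord' a b c : a < b < c -> c < N -> btw (p a) (p c) (p b) = false.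
  move=> h h'; apply/negP => b'; have := btw_eqr HS (ord _ _ _ h h') b'.
  by move/(proj1 cp) => h''; suff: b = c; [lia|apply: h''; lia].
have [h|[h|[h|[h|[h|h]]]]] : i < j < k \/ k < j < i \/ j < i < k \/ k < i < j \/
    i < k < j \/ j < k < i by lia.
- by rewrite h ord //; lia.
- by rewrite h orbT btw_sym // ord //; lia.
- by rewrite nord //; lia.
- by rewrite btw_sym // nord' //; lia.
- by rewrite nord' //; lia.
- by rewrite btw_sym // nord //; lia.
Qed.

Lemma frame_rev : frame S N t -> frame S N (rev_table N t).
Proof.
case=> p [y [cp yp cS st]]; exists (fun i => p (N.-1 - i)), y.
split; [exact: chain_rev|by rewrite pset_rev|by []|move=> a b h].
rewrite (table_rev HS cp yp) // /rev_table st //; lia.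
Qed.

Lemma frame_same t' : same_table N t t' -> frame S N t -> frame S N t'.
Proof.
move=> e [p [y [cp yp cS st]]]; exists p, y; split=> // a b h.
by rewrite st // e.
Qed.

Lemma frame_cosize : frame S N t -> cosize S = off N t.
Proof.
case=> p [y [cp yp cS st]]; rewrite -(off_same st) -(tris_off HS cp yp).
have -> : y |: pset p N = [set: S].
  by apply/eqP; rewrite eqEcard subsetT cardsT cS cardsU1 yp card_pset // add1n leqnn.
by rewrite /cosize /tris; apply: eq_card => T; rewrite [RHS]inE subsetT andbT.
Qed.
End Frame.

(** The table computes every betweenness through [frame_btw], so matching points of equal index
    preserves it. Comparing a structure with a graph thus reduces to comparing tables. *)
Lemma frame_isomorphic S S' N t : betweenness S -> betweenness S' ->
  frame S N t -> frame S' N t -> isomorphic S S'.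
Proof.
move=> HS HS' /(frame_enum HS) [q qs [qi qb]] /(frame_enum HS') [q' qs' [qi' qb']].
have ex x : exists i, (i <= N) && (x == q i).
  by case: (qs x) => i iN ->; exists i; rewrite iN eqxx.
have ex' x : exists i, (i <= N) && (x == q' i).
  by case: (qs' x) => i iN ->; exists i; rewrite iN eqxx.
pose r x := ex_minn (ex x); pose r' x := ex_minn (ex' x).
have rP x : r x <= N /\ x = q (r x).
  by rewrite /r; case: ex_minnP => i /andP[? /eqP].
have rP' x : r' x <= N /\ x = q' (r' x).
  by rewrite /r'; case: ex_minnP => i /andP[? /eqP].
exists (fun x => q' (r x)).
  exists (fun x => q (r' x)) => x.
    have [h1 h2] := rP x; have [h1' h2'] := rP' (q' (r x)).
    by rewrite [RHS]h2; congr q; apply: qi'.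
  have [h1 h2] := rP' x; have [h1' h2'] := rP (q (r' x)).
  by rewrite [RHS]h2; congr q'; apply: qi.
move=> x y z.
case: (rP x) (rP y) (rP z) => [x1 x2] [y1 y2] [z1 z2].
by rewrite [in RHS]x2 [in RHS]y2 [in RHS]z2 qb // qb'.
Qed.

Lemma isomorphic_betweenness S S' : isomorphic S S' -> betweenness S' -> betweenness S.
Proof.
case=> f fb fE [h0 h1 h2 h3 h4]; split.
- by rewrite (bij_eq_card fb).
- by move=> x z; rewrite -fE.
- by move=> x y z; rewrite -!fE; apply: h2.
- by move=> x y z; rewrite -!fE => h h'; apply: (bij_inj fb); apply: h3 h h'.
- by move=> x y z w; rewrite -!fE; apply: h4.
Qed.

Lemma isomorphic_frame S S' N t : isomorphic S S' -> frame S' N t -> frame S N t.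
Proof.
case=> f fb fE; case: (fb) => g fK gK [p [y [cp yp cS st]]].
have gE x y' z : btw (g x) (g y') (g z) = btw x y' z by rewrite -fE !gK.
exists (g \o p), (g y); split.
- case: cp => inj ord; split=> [i j iN jN /= /(can_inj gK)|i j k ij jk kN] /=.
    exact: inj.
  by rewrite gE; apply: ord.
- apply: contra yp => /psetP [i iN /= /(can_inj gK) ->].
  exact: mem_pset.
- by rewrite (bij_eq_card fb).
by move=> a b h; rewrite -st // /table /place /= !gE.
Qed.

Lemma pattern_frame S : betweenness S -> 0 < cosize S -> cosize S + 11 <= 2 * #|S| ->
  exists2 t, frame S #|S|.-1 t & pattern #|S|.-1 t.
Proof.
move=> HS pos le.
have trisT : #|tris [set: S]| = cosize S.
  by apply: eq_card => T; rewrite [LHS]inE subsetT andbT.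
have [y _ y0] : exists2 y, y \in [set: S] & #|tris ([set: S] :\ y)| = 0.
  by apply: linear_deletion; rewrite ?trisT // cardsT.
have cB : #|[set: S] :\ y| = #|S|.-1.
  by rewrite -cardsT (cardsD1 y [set: S]) inE.
have [p cp e] : exists2 p, chain p #|[set: S] :\ y| & pset p #|[set: S] :\ y| = [set: S] :\ y.
  by apply: linear_chain => //; rewrite cB; lia.
rewrite cB in cp e.
have yp : y \notin pset p #|S|.-1 by rewrite e !inE eqxx.
have eT : y |: pset p #|S|.-1 = [set: S] by rewrite e setD1K // inE.
have N4 : 4 <= #|S|.-1 by lia.
have h : #|tris (y |: pset p #|S|.-1)| <= 2 * #|S|.-1 - 8 by rewrite eT trisT; lia.
have [q [cq eq pt]] := chain_pattern HS cp yp N4 h.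
exists (table q y) => //; exists q, y; rewrite eq; split=> //.
by rewrite prednK //; lia.
Qed.

(** * Betweenness of the shortest-path metric *)

(** The axioms are restricted to [A] because [label] also contains names x_a that are not vertices.
    Natural values suffice, all edge weights being natural numbers. *)
Record nat_metric (A : label -> bool) (D : label -> label -> nat) : Prop := NatMetric {
  nat_metric0 : forall u v, A u -> A v -> (D u v == 0) = (u == v);
  nat_metricC : forall u v, D u v = D v u;
  nat_metricD : forall u v w, A u -> A v -> A w -> D u w <= D u v + D v w }.

Section GraphMetric.
Context (R : realType) (n : nat) (E : seq edge) (D : label -> label -> nat).
Let A := [pred u in labels n].
Let joins (u v : label) (e : edge) := (e.1 == (u, v)) || (e.1 == (v, u)).
Context (HD : nat_metric A D) (uE : uniq E) (rk : label -> nat).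
Context (hE : forall e, e \in E -> rk e.1.1 < rk e.1.2 /\ D e.1.1 e.1.2 = e.2).
Context (greedy : forall u v, u \in labels n -> v \in labels n -> u != v ->
  exists w, [/\ w \in labels n, u != w, D u v = D u w + D w v & has (joins u w) E]).
Implicit Types (u v w : seq_sub (labels n)).

(** As [rk] increases along each listed edge, no edge is listed in both directions; as its weight is
    given by [D], two listed edges joining the same points coincide. The sum therefore has at most
    one term. *)
Lemma weightE u v : list_weight R E u v =
  if has (joins (val u) (val v)) E then (D (val u) (val v))%:R%R else 0%R.
Proof.
rewrite /list_weight; case: hasP => [[e eE je]|no]; last first.
  by rewrite big1_seq // => e /andP[je eE]; case: no; exists e.
rewrite big_mkcond (bigD1_seq e) //= ifT // big1_seq ?GRing.addr0.
  have [_ <-] := hE eE; case/orP: je => /eqP -> //=.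
  by rewrite (nat_metricC HD).
move=> e' /andP[ne eE']; case: ifP => // je'; case/eqP: ne.
have [r1 d1] := hE eE; have [r2 d2] := hE eE'.
move: je je' r1 r2 d1 d2; case: e {eE} => -[a b] x; case: e' {eE'} => -[a' b'] x' /=.
by rewrite /joins /= => /orP[] /eqP [-> ->] /orP[] /eqP [-> ->] h1 h2 <- <- //; lia.
Qed.

Let Du u v : R := (D (val u) (val v))%:R%R.

Let W := graph_of R n E.

Lemma path_length_ge u p : path (@adj R W) u p -> (Du u (last u p) <= path_length (W := W) u p)%R.
Proof.
elim: p u => [|v p IH] u /=.
  by rewrite /Du; have /eqP -> : D (val u) (val u) == 0 by rewrite (nat_metric0 HD) ?inE ?ssvalP.
move=> /andP[uv /IH h].
have -> : list_weight R E u v = Du u v.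
  by move: uv; rewrite /adj /= weightE; case: ifP => //; rewrite ltxx.
apply: le_trans (lerD (lexx _) h).
by rewrite /Du -natrD ler_nat (nat_metricD HD) ?inE ?ssvalP.
Qed.

(** Greedy descent: each step goes to a neighbour on a shortest way to v. The distance to v strictly
    decreases, which makes the path simple, as [dist] demands. *)
Lemma geodesic u v : exists p, [/\ path (@adj R W) u p, last u p = v, uniq (u :: p),
  path_length (W := W) u p = Du u v & all (fun x => D (val x) (val v) < D (val u) (val v)) p].
Proof.
have [m] := ubnP (D (val u) (val v)); elim: m u => // m IH u hm.
case: (eqVneq u v) => [->|uv].
  exists [::]; split=> //=.
  by rewrite /Du; have /eqP -> : D (val v) (val v) == 0 by rewrite (nat_metric0 HD) ?inE ?ssvalP.
have [w [wn uw e h]] := greedy (ssvalP u) (ssvalP v) uv.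
pose w' : seq_sub (labels n) := SeqSub wn.
have Duw : 0 < D (val u) w by rewrite lt0n (nat_metric0 HD) ?inE ?ssvalP.
have lt : D w (val v) < D (val u) (val v) by rewrite e -[X in X < _]add0n ltn_add2r.
have [|p [pp lp up ep ap]] := IH w'; first exact: leq_trans lt _.
have all' : all (fun x => D (val x) (val v) < D (val u) (val v)) (w' :: p).
  rewrite /= lt; apply: sub_all ap => x /= hx; exact: ltn_trans hx lt.
have we : list_weight R E u w' = Du u w' by rewrite weightE /= h.
exists (w' :: p); split=> //.
- rewrite /= pp andbT /adj /= we /Du ltr0n //.
- rewrite cons_uniq up andbT; apply/negP => /(allP all') /=; by rewrite ltnn.
- by rewrite [LHS]/= we ep /Du -natrD /= -e.
Qed.

Lemma distE u v : dist (W := W) u v = Du u v.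
Proof.
have lb : lbound [set l : R | exists p : seq (vertex W), [/\ path (@adj R W) u p,
    last u p = v, uniq (u :: p) & l = path_length (W := W) u p]]%classic (Du u v).
  by move=> _ [p [pp <- _ ->]]; apply: path_length_ge.
have [p [pp lp up ep _]] := geodesic u v.
apply/le_anti/andP; split.
  by apply: ge_inf; [exists (Du u v)|exists p].
by apply: lb_le_inf lb; exists (path_length (W := W) u p), p.
Qed.

Lemma induced_btw (u v w : induced_of R n E) :
  btw u v w = (D (val u) (val w) == D (val u) (val v) + D (val v) (val w)).
Proof.
have dE := distE; rewrite /W /= in dE.
by rewrite /= !dE /Du -natrD eqr_nat.
Qed.

End GraphMetric.

Lemma metric_betweenness (S : structure) (D : S -> S -> nat) : 0 < #|S| ->
  (forall x y z : S, btw x y z = (D x z == D x y + D y z)) ->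
  (forall x y, (D x y == 0) = (x == y)) -> (forall x y, D x y = D y x) ->
  (forall x y z, D x z <= D x y + D y z) -> betweenness S.
Proof.
move=> S0 bE m0 mC mD.
have D0 x : D x x = 0 by apply/eqP; rewrite m0.
split=> //.
- by move=> x z; rewrite bE D0.
- by move=> x y z; rewrite !bE (mC z x) (mC z y) (mC y x) addnC.
- move=> x y z; rewrite !bE (mC y x) => /eqP e1 /eqP e2.
  apply/eqP; rewrite -m0.
  by move: (D x y) (D x z) (D y z) e1 e2; lia.
move=> x y z w; rewrite !bE => /eqP e1 /eqP e2.
by move: e1 e2 (mD x w z) (mD w y z);
  move: (D x y) (D x z) (D x w) (D y z) (D w z) (D w y); lia.
Qed.

(** A certificate that [D] is the shortest-path metric of the edge list: [D] bounds path lengths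
    from below by the triangle inequality, and [gg_step] supplies a path that attains it. *)
Record geodesic_graph (n : nat) (E : seq edge) (D : label -> label -> nat) : Prop :=
  GeodesicGraph {
  gg_metric : nat_metric [pred u in labels n] D;
  gg_uniq : uniq E;
  gg_orient : exists rk : label -> nat,
    forall e, e \in E -> rk e.1.1 < rk e.1.2 /\ D e.1.1 e.1.2 = e.2;
  gg_step : forall u v, u \in labels n -> v \in labels n -> u != v ->
    exists w, [/\ w \in labels n, u != w, D u v = D u w + D w v &
      has (fun e : edge => (e.1 == (u, w)) || (e.1 == (w, u))) E] }.

(** [DY a] is the distance from the extra point to the a-th point of the line, and [P a] is the
    coordinate of that point. *)
Definition metric_table (DY P : nat -> nat) (a b : nat) : letter :=
  if DY b == DY a + (P b - P a) then L
  else if DY a == DY b + (P b - P a) then R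
  else if P b - P a == DY a + DY b then M else O.

Lemma vx_inj : injective vx. Proof. by move=> a b []. Qed.

Lemma mem_labels_x n a : (vx a \in labels n) = (1 <= a <= n - 2).
Proof.
rewrite /labels mem_cat (mem_map vx_inj) mem_iota !inE /= orbF.
by rewrite /vx /vy /vz; lia.
Qed.

Lemma mem_labels_yz n (b : bool) : (inr b : label) \in labels n.
Proof. by rewrite /labels mem_cat !inE; case: b; rewrite ?eqxx ?orbT. Qed.

Lemma size_labels n : 2 <= n -> size (labels n) = n.
Proof. by move=> n2; rewrite size_cat size_map size_iota /=; lia. Qed.

Lemma uniq_labels n : uniq (labels n).
Proof.
rewrite cat_uniq (map_inj_uniq vx_inj) iota_uniq /= andbT orbF.
by apply/norP; split; apply/mapP => -[].
Qed.

Section Induced.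
Context (R : realType) (n : nat) (E : seq edge) (D : label -> label -> nat).
Context (n2 : 2 <= n) (gg : geodesic_graph n E D).
Let W := induced_of R n E.

Lemma induced_btwE (u v w : W) :
  btw u v w = (D (val u) (val w) == D (val u) (val v) + D (val v) (val w)).
Proof.
have [rk hE] := gg_orient gg.
exact: (induced_btw (gg_metric gg) (gg_uniq gg) hE (gg_step gg)).
Qed.

Lemma card_induced : #|W| = n.
Proof. by rewrite (card_seq_sub (uniq_labels n)) size_labels. Qed.

Lemma induced_betweenness : betweenness W.
Proof.
have [m0 mC mD] := gg_metric gg.
have lab (x : W) : [pred u in labels n] (val x) by rewrite /= ssvalP.
apply: (@metric_betweenness W (fun x y => D (val x) (val y))) => [||x y|x y|x y z].
- by rewrite card_induced ltnW.
- exact: induced_btwE.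
- by rewrite m0.
- exact: mC.
- exact: mD.
Qed.

Lemma induced_frame (w : label) (p : nat -> label) (P : nat -> nat) :
  w \in labels n -> (forall a, a < n.-1 -> p a \in labels n /\ p a != w) ->
  (forall a b, a < b < n.-1 -> P a < P b /\ D (p a) (p b) = P b - P a) ->
  frame W n.-1 (metric_table (fun a => D w (p a)) P).
Proof.
move=> wn pn DP.
have [m0 mC mD] := gg_metric gg.
pose w' : seq_sub (labels n) := SeqSub wn.
pose q a : W := insubd w' (p a).
have qE a : a < n.-1 -> val (q a) = p a.
  by move=> /pn [h _]; rewrite /q insubdK.
exists q, w'; split.
- split=> [i j iN jN e|i j k ij jk kN].
    have {}e : p i = p j by rewrite -!qE // e.
    have D0 : D (p i) (p i) = 0 by apply/eqP; rewrite m0 ?eqxx //=; case: (pn _ iN).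
    case: (ltngtP i j) => // lt.
      by have := DP i j; rewrite lt jN -e D0 => /(_ isT); lia.
    by have := DP j i; rewrite lt iN -e D0 => /(_ isT); lia.
  rewrite induced_btwE !qE; try lia.
  have h1 := DP i j; have h2 := DP j k; have h3 := DP i k.
  case: h1; first lia. case: h2; first lia. case: h3; first lia.
  by move=> a1 -> a2 -> a3 ->; lia.
- apply/psetP => -[i iN /(congr1 val)]; rewrite qE //= => e.
  by have [_] := pn _ iN; rewrite e eqxx.
- by rewrite card_induced prednK // ltnW.
move=> a b h; rewrite /table /place !induced_btwE !qE /=; try lia.
have [_ e] := DP _ _ h; rewrite e (mC (p b) w) (mC (p a) w).
by rewrite /metric_table (addnC (P b - P a)).
Qed.
End Induced.

Definition absd (a b : nat) : nat := (a - b) + (b - a).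

Definition line_dist (pos : nat -> nat) (py pz d : nat) (u v : label) : nat :=
  match u, v with
  | inl a, inl b => absd (pos a) (pos b)
  | inl a, inr c => absd (pos a) (if c then pz else py)
  | inr c, inl a => absd (pos a) (if c then pz else py)
  | inr b, inr c => if b == c then 0 else d
  end.

Lemma line_metric n pos py pz d : 0 < d ->
  (forall a b, 1 <= a <= n - 2 -> 1 <= b <= n - 2 -> pos a = pos b -> a = b) ->
  (forall a, 1 <= a <= n - 2 ->
     [/\ pos a != py, pos a != pz, d <= absd (pos a) py + absd (pos a) pz,
         absd (pos a) py <= d + absd (pos a) pz & absd (pos a) pz <= d + absd (pos a) py]) ->
  nat_metric [pred u in labels n] (line_dist pos py pz d).
Proof.
move=> d0 inj hx.
have labE u : [pred u in labels n] u -> if u is inl a then 1 <= a <= n - 2 else true.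
  by case: u => //= a; rewrite -mem_labels_x.
split.
- move=> [a|b] [a'|b'] /labE hu /labE hv /=.
  + apply/eqP/eqP => [h|[->]]; last by rewrite /absd; lia.
    by congr inl; apply: inj => //; rewrite /absd in h; lia.
  + by have [h1 h2 _ _ _] := hx _ hu; rewrite /absd; case: b'; apply/eqP/eqP; rewrite //; lia.
  + by have [h1 h2 _ _ _] := hx _ hv; rewrite /absd; case: b; apply/eqP/eqP; rewrite //; lia.
  + by case: b hu; case: b' hv => //= _ _; rewrite ?eqxx //; apply/eqP/eqP => //; lia.
- move=> [a|b] [a'|b'] //=; first by rewrite /absd addnC.
  by rewrite eq_sym.
move=> [a|b] [a'|b'] [a''|b''] /labE hu /labE hv /labE hw /=.
all: try by rewrite /absd; lia.
- have [_ _ h1 h2 h3] := hx _ hu.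
  by move: h1 h2 h3; rewrite /absd; case: b' hv; case: b'' hw => /= _ _; lia.
- have [_ _ h1 h2 h3] := hx _ hv.
  by move: h1 h2 h3; rewrite /absd; case: b hu; case: b'' hw => /= _ _; lia.
- have [_ _ h1 h2 h3] := hx _ hw.
  by move: h1 h2 h3; rewrite /absd; case: b hu; case: b' hv => /= _ _; lia.
by case: b hu; case: b' hv; case: b'' hw => /= _ _ _; lia.
Qed.

(** * The graphs Q, R and S *)

Lemma path_edge n a : 1 <= a <= n - 3 -> (vx a, vx a.+1, 1) \in path_edges n.
Proof. by move=> h; apply/mapP; exists a; rewrite // mem_iota; lia. Qed.

Lemma path_edge_del n i a : 1 <= a <= n - 3 -> a != i ->
  (vx a, vx a.+1, 1) \in path_edges_del n i.
Proof.
move=> h ai; rewrite mem_filter path_edge // andbT /=.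
by apply: contra ai => /eqP [->].
Qed.

Lemma path_edgesP n e : e \in path_edges n ->
  exists2 a, 1 <= a <= n - 3 & e = (vx a, vx a.+1, 1).
Proof. by case/mapP => a; rewrite mem_iota => h ->; exists a => //; lia. Qed.

Lemma path_edges_delP n i e : e \in path_edges_del n i ->
  exists2 a, (1 <= a <= n - 3) && (a != i) & e = (vx a, vx a.+1, 1).
Proof.
rewrite mem_filter => /andP[ne /path_edgesP [a h e']].
exists a; rewrite // h /=; by apply: contra ne => /eqP ai; rewrite e' ai.
Qed.

Lemma uniq_path_edges n : uniq (path_edges n).
Proof. by rewrite map_inj_uniq ?iota_uniq // => a b []. Qed.

(* An edge with y or z as an end point. *)
Definition extra_edge (e : edge) : bool :=
  if e is ((inl _, inl _), _) then false else true.

Lemma uniq_with_extra (P : pred edge) n (ex : seq edge) : uniq ex -> all extra_edge ex ->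
  uniq ([seq e <- path_edges n | P e] ++ ex).
Proof.
move=> uex /allP hex; rewrite cat_uniq filter_uniq ?uniq_path_edges // uex andbT /=.
apply/hasPn => e /hex he; rewrite mem_filter negb_and orbC.
by apply/orP; left; apply: contraL he => /path_edgesP [a _ ->].
Qed.

Definition joins (u w : label) (e : edge) : bool := (e.1 == (u, w)) || (e.1 == (w, u)).

Lemma has_fwd (E : seq edge) u w x : (u, w, x) \in E -> has (joins u w) E.
Proof. by move=> h; apply/hasP; exists (u, w, x) => //=; rewrite /joins eqxx. Qed.

Lemma has_bwd (E : seq edge) u w x : (w, u, x) \in E -> has (joins u w) E.
Proof. by move=> h; apply/hasP; exists (w, u, x) => //=; rewrite /joins eqxx orbT. Qed.

Definition Q_graph (n : nat) (tl : seq edge) : seq edge :=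
  path_edges n ++ [:: (vy, vx 1, 1); (vz, vx 1, 1)] ++ tl.

(** Treats both variants at once: the distance d between y and z is 2, through a common neighbour,
    or 1, through the additional edge. *)
Definition tail_for (d : nat) (tl : seq edge) : Prop :=
  (d = 2 /\ tl = [::]) \/ (d = 1 /\ tl = [:: (vy, vz, 1)]).

Lemma Q_geodesic n d tl : 3 <= n -> tail_for d tl ->
  geodesic_graph n (Q_graph n tl) (line_dist (fun a => a) 0 0 d).
Proof.
move=> n3 hd.
have d12 : d = 1 \/ d = 2 by case: hd => -[-> _]; [right|left].
split.
- apply: line_metric => [|//|a ha]; first lia.
  by rewrite /absd; split; lia.
- rewrite /Q_graph -(filter_predT (path_edges n)); apply: uniq_with_extra.
    by case: hd => -[_ ->].
  by case: hd => -[_ ->].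
(* The ranks order the vertices as y, z, x_1, x_2 and so on, in accordance with the direction in
   which edges are listed. *)
- exists (fun u : label => if u is inl a then a.+2 else u == vz) => e.
  rewrite !mem_cat => /or3P[/path_edgesP [a ha ->]||] /=; first by rewrite /absd; lia.
    by rewrite !inE => /orP[] /eqP -> /=; rewrite /absd; lia.
  by case: hd => -[-> ->] //; rewrite inE => /eqP -> /=.

have lF a : 1 <= a <= n - 3 -> has (joins (vx a) (vx a.+1)) (Q_graph n tl).
  by move=> ha; apply: (@has_fwd _ _ _ 1); rewrite mem_cat path_edge.
have lB a : 2 <= a <= n - 2 -> has (joins (vx a) (vx a.-1)) (Q_graph n tl).
  case: a => // a ha; apply: (@has_bwd _ _ _ 1).
  by rewrite mem_cat path_edge //=; lia.
have yE c : has (joins (inr c) (vx 1)) (Q_graph n tl) /\ has (joins (vx 1) (inr c)) (Q_graph n tl).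
  have h : ((inr c : label), vx 1, 1) \in Q_graph n tl.
    by rewrite mem_cat mem_cat !inE; case: c; rewrite ?eqxx ?orbT.
  by split; [apply: has_fwd h|apply: has_bwd h].
move=> [a|b] [a'|b']; rewrite ?mem_labels_x => hu hv uv.
- case: (ltngtP a a') => lt.
  + exists (vx a.+1); rewrite mem_labels_x; split; [lia|by apply/eqP => -[]; lia| |].
      by rewrite /= ?if_same /absd; lia.
    by apply: lF; lia.
  + exists (vx a.-1); rewrite mem_labels_x; split; [lia|by apply/eqP => -[]; lia| |].
      by rewrite /= ?if_same /absd; lia.
    by apply: lB; lia.
  by rewrite lt eqxx in uv.
- case: (ltnP 1 a) => h.
    exists (vx a.-1); rewrite mem_labels_x; split; [lia|by apply/eqP => -[]; lia| |].
      by rewrite /= ?if_same /absd; lia.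
    by apply: lB; lia.
  exists (inr b'); rewrite mem_labels_yz; split=> //; first by rewrite /= eqxx addn0.
  have -> : a = 1 by lia.
  by case: (yE b').
- exists (vx 1); rewrite mem_labels_x; split=> //; [lia| |by case: (yE b)].
  by rewrite /= ?if_same /absd; lia.
case: hd => -[-> e].
  exists (vx 1); rewrite mem_labels_x; split=> //; [lia| |by case: (yE b)].
  by case: b hu uv yE; case: b' hv => //=.
exists (inr b'); rewrite mem_labels_yz; split=> //; first by rewrite /= eqxx addn0.
have h : (vy, vz, 1) \in Q_graph n tl by rewrite mem_cat e mem_cat !inE eqxx !orbT.
by case: b uv {hu}; case: b' {hv} => // _; [apply: has_bwd h|apply: has_fwd h].
Qed.

Definition R_graph (n i g : nat) (tl : seq edge) : seq edge :=
  path_edges_del n i ++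
  [:: (vy, vx i, 1); (vz, vx i, 1); (vy, vx i.+1, g); (vz, vx i.+1, g)] ++ tl.

(** Both y and z take coordinate i + 1, so the points after the deleted edge move up by g, the
    weight of the edges to x_{i+1}: 2 for R3 and 1 for R2 and R4. *)
Definition R_pos (i g a : nat) : nat := if a <= i then a else a + g.

Lemma R_geodesic n i g d tl : 4 <= n -> 1 <= i <= n - 3 -> g = 1 \/ g = 2 -> tail_for d tl ->
  geodesic_graph n (R_graph n i g tl) (line_dist (R_pos i g) i.+1 i.+1 d).
Proof.
move=> n4 hi hg hd.
have d12 : d = 1 \/ d = 2 by case: hd => -[-> _]; [right|left].
have pE a : R_pos i g a = if a <= i then a else a + g by [].
split.
- apply: line_metric => [|a b ha hb|a ha]; first lia.
    by rewrite !pE; case: leqP => h; case: leqP => h'; lia.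
  by rewrite pE /absd; case: leqP => h; split; lia.
- apply: uniq_with_extra.
    pose f (e : edge) := (if e.1.2 is inl a then a else 0) * 2 + (e.1.1 == vz).
    by apply: (@map_uniq _ _ f); case: hd => -[_ ->]; rewrite /f /= !inE; lia.
  by case: hd => -[_ ->].
- exists (fun u : label => if u is inl a then a.+2 else u == vz) => e.
  rewrite mem_cat mem_cat => /or3P[/path_edges_delP [a ha ->]||] /=.
  + by rewrite !pE /absd; case: (leqP a i) => h; case: (ltnP a i) => h'; lia.
  + by rewrite !inE => /or4P[] /eqP -> /=; rewrite ?if_same pE ?leqnn ?ltnn /absd; lia.
  by case: hd => -[-> ->] //; rewrite inE => /eqP -> /=.
have lF a : 1 <= a <= n - 3 -> a != i -> has (joins (vx a) (vx a.+1)) (R_graph n i g tl).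
  by move=> ha ai; apply: (@has_fwd _ _ _ 1); rewrite mem_cat path_edge_del.
have lB a : 2 <= a <= n - 2 -> a != i.+1 -> has (joins (vx a) (vx a.-1)) (R_graph n i g tl).
  case: a => // a ha ai; apply: (@has_bwd _ _ _ 1).
  by rewrite mem_cat path_edge_del //=; lia.
have yI c : has (joins (inr c) (vx i)) (R_graph n i g tl) /\
    has (joins (vx i) (inr c)) (R_graph n i g tl).
  have h : ((inr c : label), vx i, 1) \in R_graph n i g tl.
    by rewrite !mem_cat !inE; case: c; rewrite ?eqxx ?orbT.
  by split; [apply: has_fwd h|apply: has_bwd h].
have yJ c : has (joins (inr c) (vx i.+1)) (R_graph n i g tl) /\
    has (joins (vx i.+1) (inr c)) (R_graph n i g tl).
  have h : ((inr c : label), vx i.+1, g) \in R_graph n i g tl.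
    by rewrite !mem_cat !inE; case: c; rewrite ?eqxx ?orbT.
  by split; [apply: has_fwd h|apply: has_bwd h].
have DE a b : line_dist (R_pos i g) i.+1 i.+1 d (vx a) (vx b) = absd (R_pos i g a) (R_pos i g b) by [].
have Dxy a c : line_dist (R_pos i g) i.+1 i.+1 d (vx a) (inr c) = absd (R_pos i g a) i.+1.
  by rewrite /= if_same.
have Dyx a c : line_dist (R_pos i g) i.+1 i.+1 d (inr c) (vx a) = absd (R_pos i g a) i.+1.
  by rewrite /= if_same.
move=> [a|b] [a'|b']; rewrite ?mem_labels_x => hu hv uv.
- case: (ltngtP a a') => lt; last by rewrite lt eqxx in uv.
  + case: (eqVneq a i) => ai.
      exists vy; rewrite mem_labels_yz ai; split=> //; last by case: (yI false).
      by rewrite DE Dxy Dyx !pE /absd leqnn; case: leqP => h; lia.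
    exists (vx a.+1); rewrite mem_labels_x; split; [lia|by apply/eqP => -[]; lia| |].
      rewrite !DE !pE /absd; case: (leqP a i) => h; case: (ltnP a i) => h';
      case: (leqP a' i) => h''; lia.
    by apply: lF; lia.
  + case: (eqVneq a i.+1) => ai.
      exists vy; rewrite mem_labels_yz ai; split=> //; last by case: (yJ false).
      by rewrite DE Dxy Dyx !pE /absd ltnn; case: leqP => h; lia.
    exists (vx a.-1); rewrite mem_labels_x; split; [lia|by apply/eqP => -[]; lia| |].
      rewrite !DE !pE /absd; case: (leqP a i) => h; case: (leqP a.-1 i) => h';
      case: (leqP a' i) => h''; lia.
    by apply: lB; lia.
- case: (ltngtP a i) => ai.
  + exists (vx a.+1); rewrite mem_labels_x; split; [lia|by apply/eqP => -[]; lia| |].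
      by rewrite DE !Dxy !pE /absd; case: (leqP a i) => h; case: (ltnP a i) => h'; lia.
    by apply: lF; lia.
  + case: (eqVneq a i.+1) => ai'.
      exists (inr b'); rewrite mem_labels_yz ai'; split=> //; last by case: (yJ b').
      by rewrite Dxy /= eqxx addn0.
    exists (vx a.-1); rewrite mem_labels_x; split; [lia|by apply/eqP => -[]; lia| |].
      by rewrite DE !Dxy !pE /absd; case: (leqP a i) => h; case: (leqP a.-1 i) => h'; lia.
    by apply: lB; lia.
  exists (inr b'); rewrite mem_labels_yz ai; split=> //; last by case: (yI b').
  by rewrite Dxy /= eqxx addn0.
- case: (leqP a' i) => h.
    exists (vx i); rewrite mem_labels_x; split=> //; [lia| |by case: (yI b)].
    by rewrite DE !Dyx !pE /absd h leqnn; lia.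
  exists (vx i.+1); rewrite mem_labels_x; split=> //; [lia| |by case: (yJ b)].
  by rewrite DE !Dyx !pE /absd ltnn leqNgt h /=; lia.
case: hd => -[de e].
  exists (vx i); rewrite mem_labels_x; split=> //; [lia| |by case: (yI b)].
  by rewrite Dyx Dxy /= de pE leqnn /absd; case: b hu uv; case: b' hv => //= _ _ _; lia.
exists (inr b'); rewrite mem_labels_yz; split=> //; first by rewrite /= eqxx addn0.
have h : (vy, vz, 1) \in R_graph n i g tl by rewrite !mem_cat e !inE eqxx !orbT.
by case: b uv {hu}; case: b' {hv} => // _; [apply: has_bwd h|apply: has_fwd h].
Qed.

(** The pairs (h, d) are (1, n - 3) for S4, (2, n - 2) for S3 and (1, n - 2) for S2. *)
Definition S_graph (n h d : nat) : seq edge :=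
  path_edges n ++ [:: (vx 1, vy, 1); (vx (n - 2), vz, h); (vy, vz, d)].

(** The last two inequalities are the triangle inequalities of y and z with x_1 and with x_{n-2},
    the extreme cases. The bound [d < n - 2 + h] makes the edge yz shorter than the way along the
    path. *)
Lemma S_geodesic n h d : 4 <= n -> 0 < h -> 0 < d -> d < n - 2 + h -> n - 4 + h <= d ->
  n - 2 <= d + h ->
  geodesic_graph n (S_graph n h d) (line_dist (fun a => a) 0 (n - 2 + h) d).
Proof.
move=> n4 h0 d0 d1 d2 d3.
split.
- apply: line_metric => // a ha.
  by rewrite /absd; split; lia.
- rewrite /S_graph -(filter_predT (path_edges n)); apply: uniq_with_extra => //.
  by apply: (@map_uniq _ _ (fun e : edge => (e.1.1 == vy) * 2 + (e.1.2 == vz))).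
- exists (fun u : label => if u is inl a then a else n + (u == vz)) => e.
  rewrite mem_cat => /orP[/path_edgesP [a ha ->]|] /=; first by rewrite /absd; lia.
  by rewrite !inE => /or3P[] /eqP -> /=; rewrite /absd; lia.
have lF a : 1 <= a <= n - 3 -> has (joins (vx a) (vx a.+1)) (S_graph n h d).
  by move=> ha; apply: (@has_fwd _ _ _ 1); rewrite mem_cat path_edge.
have lB a : 2 <= a <= n - 2 -> has (joins (vx a) (vx a.-1)) (S_graph n h d).
  case: a => // a ha; apply: (@has_bwd _ _ _ 1).
  by rewrite mem_cat path_edge //=; lia.
have e1 : (vx 1, vy, 1) \in S_graph n h d by rewrite mem_cat !inE eqxx !orbT.
have e2 : (vx (n - 2), vz, h) \in S_graph n h d by rewrite mem_cat !inE eqxx !orbT.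
have e3 : (vy, vz, d) \in S_graph n h d by rewrite mem_cat !inE eqxx !orbT.
move=> [a|b] [a'|b']; rewrite ?mem_labels_x => hu hv uv.
- case: (ltngtP a a') => lt; last by rewrite lt eqxx in uv.
  + exists (vx a.+1); rewrite mem_labels_x; split; [lia|by apply/eqP => -[]; lia| |].
      by rewrite /= ?if_same /absd; lia.
    by apply: lF; lia.
  + exists (vx a.-1); rewrite mem_labels_x; split; [lia|by apply/eqP => -[]; lia| |].
      by rewrite /= ?if_same /absd; lia.
    by apply: lB; lia.
- case: b' hv uv => _ _.
    case: (ltnP a (n - 2)) => lt.
      exists (vx a.+1); rewrite mem_labels_x; split; [lia|by apply/eqP => -[]; lia| |].
        by rewrite /= /absd; lia.
      by apply: lF; lia.
    exists vz; rewrite mem_labels_yz; split=> //; first by rewrite /= addn0.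
    have -> : a = n - 2 by lia.
    exact: has_fwd e2.
  case: (ltnP 1 a) => lt.
    exists (vx a.-1); rewrite mem_labels_x; split; [lia|by apply/eqP => -[]; lia| |].
      by rewrite /= /absd; lia.
    by apply: lB; lia.
  exists vy; rewrite mem_labels_yz; split=> //; first by rewrite /= addn0.
  have -> : a = 1 by lia.
  exact: has_fwd e1.
- case: b hu uv => _ _.
    exists (vx (n - 2)); rewrite mem_labels_x; split=> //; [lia| |exact: has_bwd e2].
    by rewrite /= /absd; lia.
  exists (vx 1); rewrite mem_labels_x; split=> //; [lia| |exact: has_bwd e1].
  by rewrite /= /absd; lia.
exists (inr b'); rewrite mem_labels_yz; split=> //; first by rewrite /= eqxx addn0.
by case: b uv {hu}; case: b' {hv} => // _; [apply: has_bwd e3|apply: has_fwd e3].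
Qed.

Ltac ifs_lia := repeat (let h := fresh in case: ifP => h; try done; try (exfalso; lia)).

Lemma Q_frame (F : realType) n d tl : 3 <= n -> tail_for d tl ->
  frame (induced_of F n (Q_graph n tl)) n.-1 (tab_Q (if d == 2 then R else O)).
Proof.
move=> n3 hd; have gg := Q_geodesic n3 hd.
have d12 : d = 1 \/ d = 2 by case: hd => -[-> _]; [right|left].
pose p a := if a == 0 then vz else vx a.
have h : frame (induced_of F n (Q_graph n tl)) n.-1
    (metric_table (fun a => line_dist (fun a => a) 0 0 d vy (p a)) (fun a => a)).
  apply: (induced_frame F _ gg); first lia.
  - exact: mem_labels_yz.
  - move=> a ha; rewrite /p; case: (posnP a) => [_|a0] /=; first by rewrite mem_labels_yz.
    by rewrite mem_labels_x; split=> //; lia.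
  - move=> a b hab; split; first lia.
    by rewrite /p; case: (posnP a) => [->|a0] /=; case: (posnP b) => [eb|b0] /=;
      rewrite /absd; lia.
apply: frame_same h => a b hab; rewrite /metric_table /tab_Q /p.
have -> : (b == 0) = false by lia.
case: (posnP a) => [->|a0] /=.
  have [->|b1] := eqVneq b 1.
    by case: d12 => ->; rewrite /absd.
  by rewrite /absd !ifF //; lia.
by rewrite /absd ifT //; lia.
Qed.

(** The line is x_1, ..., x_i, z, x_{i+1}, ..., with z at index i. Its neighbour x_i lies between y
    and z when d = 1 + 1, and x_{i+1} does when d = g + g. *)
Lemma R_frame (F : realType) n i g d tl : 4 <= n -> 1 <= i <= n - 3 -> g = 1 \/ g = 2 ->
  tail_for d tl ->
  frame (induced_of F n (R_graph n i g tl)) n.-1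
    (tab_R i (if d == 2 then L else O) (if d == 2 * g then R else O)).
Proof.
move=> n4 hi hg hd; have gg := R_geodesic n4 hi hg hd.
have d12 : d = 1 \/ d = 2 by case: hd => -[-> _]; [right|left].
pose p a := if a < i then vx a.+1 else if a == i then vz else vx a.
pose P a := if a < i then a.+1 else if a == i then i.+1 else a + g.
have pP a : [\/ [/\ a < i, p a = vx a.+1, P a = a.+1 & R_pos i g a.+1 = a.+1],
     [/\ a = i, p a = vz & P a = i.+1] |
     [/\ i < a, p a = vx a, P a = a + g & R_pos i g a = a + g]].
  rewrite /p /P /R_pos; case: ltngtP => h; by [apply: Or31|apply: Or33|apply: Or32].
have DE a b : line_dist (R_pos i g) i.+1 i.+1 d (vx a) (vx b) = absd (R_pos i g a) (R_pos i g b) by [].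
have Dxy a c : line_dist (R_pos i g) i.+1 i.+1 d (vx a) (inr c) = absd (R_pos i g a) i.+1.
  by rewrite /= if_same.
have Dyx a c : line_dist (R_pos i g) i.+1 i.+1 d (inr c) (vx a) = absd (R_pos i g a) i.+1.
  by rewrite /= if_same.
have h : frame (induced_of F n (R_graph n i g tl)) n.-1
    (metric_table (fun a => line_dist (R_pos i g) i.+1 i.+1 d vy (p a)) P).
  apply: (induced_frame F _ gg); first lia.
  - exact: mem_labels_yz.
  - move=> a ha; case: (pP a) => -[h -> _] => [_||_].
    + by rewrite mem_labels_x; split=> //; lia.
    + by rewrite mem_labels_yz.
    + by rewrite mem_labels_x; split=> //; lia.
  - move=> a b hab; case: (pP a) => -[ha -> ->] => [ea||ea]; case: (pP b) => -[hb -> ->] => [eb||eb];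
      rewrite ?DE ?Dxy ?Dyx ?ea ?eb /absd; lia.
apply: frame_same h => a b hab; rewrite /metric_table /tab_R.
have Dyz : line_dist (R_pos i g) i.+1 i.+1 d vy vz = d by [].
case: (pP a) => -[ha -> ->] => [ea||ea]; case: (pP b) => -[hb -> ->] => [eb||eb];
  rewrite ?Dyx ?Dyz ?ea ?eb /absd; try lia; ifs_lia.
Qed.

(** The line is x_1, ..., x_{n-2}, z. Equality in the triangle inequality at x_{n-2} puts z between
    x_{n-2} and y; equality at x_1 puts y between x_1 and z. *)
Lemma S_frame (F : realType) n h d : 4 <= n -> 0 < h -> 0 < d -> d < n - 2 + h ->
  n - 4 + h <= d -> n - 2 <= d + h ->
  frame (induced_of F n (S_graph n h d)) n.-1
    (tab_S n.-1 (if d + h == n - 2 then R else O) (if d == n - 4 + h then M else O)).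
Proof.
move=> n4 h0 d0 d1 d2 d3; have gg := S_geodesic n4 h0 d0 d1 d2 d3.
pose p a := if a == n - 2 then vz else vx a.+1.
pose P a := if a == n - 2 then n - 2 + h else a.+1.
have pP a : (a = n - 2 /\ p a = vz /\ P a = n - 2 + h) \/
    (a != n - 2 /\ p a = vx a.+1 /\ P a = a.+1).
  by rewrite /p /P; case: eqP => e; [left|right].
have fr : frame (induced_of F n (S_graph n h d)) n.-1
    (metric_table (fun a => line_dist (fun a => a) 0 (n - 2 + h) d vy (p a)) P).
  apply: (induced_frame F _ gg); first lia.
  - exact: mem_labels_yz.
  - move=> a ha; case: (pP a) => -[e [-> _]]; rewrite ?mem_labels_yz ?mem_labels_x; split=> //; lia.
  - move=> a b hab; case: (pP a) => -[ea [-> ->]]; case: (pP b) => -[eb [-> ->]];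
      rewrite /= /absd; lia.
apply: frame_same fr => a b hab; rewrite /metric_table /tab_S.
case: (pP a) => -[ea [-> ->]]; case: (pP b) => -[eb [-> ->]]; rewrite /= /absd; try lia; ifs_lia.
Qed.

(* In S3, removing z also leaves a line, and gives another table than removing y. *)
Lemma S3_frame_z (F : realType) n : 4 <= n ->
  frame (induced_of F n (S_graph n 2 (n - 2))) n.-1 (tab_S n.-1 R O).
Proof.
move=> n4.
have gg : geodesic_graph n (S_graph n 2 (n - 2)) (line_dist (fun a => a) 0 (n - 2 + 2) (n - 2)).
  by apply: S_geodesic; lia.
pose p a := if a == n - 2 then vy else vx (n - 2 - a).
have pP a : (a = n - 2 /\ p a = vy) \/ (a != n - 2 /\ p a = vx (n - 2 - a)).
  by rewrite /p; case: eqP => e; [left|right].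
have fr : frame (induced_of F n (S_graph n 2 (n - 2))) n.-1
    (metric_table (fun a => line_dist (fun a => a) 0 (n - 2 + 2) (n - 2) vz (p a)) (fun a => a)).
  apply: (induced_frame F _ gg); first lia.
  - exact: mem_labels_yz.
  - move=> a ha; case: (pP a) => -[e ->]; rewrite ?mem_labels_yz ?mem_labels_x; split=> //; lia.
  - move=> a b hab; case: (pP a) => -[ea ->]; case: (pP b) => -[eb ->];
      rewrite /= /absd; lia.
apply: frame_same fr => a b hab; rewrite /metric_table /tab_S.
case: (pP a) => -[ea ->]; case: (pP b) => -[eb ->]; rewrite /= /absd; try lia; ifs_lia.
Qed.

(** The choices (L, R) and (O, O) are their own mirror images, so for them half of the positions
    suffice; (O, R) turns into (L, O), which therefore needs all positions. *)
Lemma rev_tab_R N k u v : 0 < k -> k.+1 < N ->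
  same_table N (rev_table N (tab_R k u v)) (tab_R (N.-1 - k) (swap v) (swap u)).
Proof.
move=> k0 kN a b hab; rewrite /rev_table /tab_R.
ifs_lia.
Qed.

(** * Two pairs of twins *)

(* Points on a line, two points at the same place being at distance 2. *)
Definition twin_dist (T : finType) (pos : T -> nat) (x y : T) : nat :=
  if x == y then 0 else if pos x == pos y then 2 else absd (pos x) (pos y).

Definition twin_structure (T : finType) (pos : T -> nat) : structure :=
  @Structure T (fun x y z => twin_dist pos x z == twin_dist pos x y + twin_dist pos y z).

Lemma twin_betweenness (T : finType) (pos : T -> nat) : 0 < #|T| ->
  betweenness (twin_structure pos).
Proof.
move=> T0; apply: (@metric_betweenness (twin_structure pos) (twin_dist pos)) => //.
- move=> x y; rewrite /twin_dist; case: (eqVneq x y) => //= ne.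
  by case: (eqVneq (pos x) (pos y)) => // ne'; rewrite /absd; lia.
- by move=> x y; rewrite /twin_dist (eq_sym x) (eq_sym (pos x)) /absd addnC.
have le x y : absd (pos x) (pos y) <= twin_dist pos x y.
  by rewrite /twin_dist /absd; case: eqP => [->|_]; [lia|case: eqP => // ->; lia].
have pos_dist x y : x != y -> 0 < twin_dist pos x y.
  by rewrite /twin_dist => /negbTE ->; case: eqP => // ne; rewrite /absd; lia.
move=> x y z.
case: (eqVneq x y) => [->|xy]; first by rewrite leq_addl.
case: (eqVneq y z) => [->|yz]; first by rewrite leq_addr.
have := pos_dist _ _ xy; have := pos_dist _ _ yz; have := le x y; have := le y z.
(* A distance of at most 2 is bounded by two positive summands; any other is a distance on the
   line. *)
have : twin_dist pos x z <= 2 \/ twin_dist pos x z = absd (pos x) (pos z).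
  by rewrite /twin_dist; case: eqP => _; [left|case: eqP => _; [left|right]].
by rewrite /absd; move: (twin_dist pos x y) (twin_dist pos y z) (twin_dist pos x z); lia.
Qed.

Lemma twin_noncol (T : finType) (pos : T -> nat) (x y z : T) :
  pos x != pos y -> pos y != pos z -> pos x != pos z ->
  noncol (S := twin_structure pos) x y z = false.
Proof.
move=> xy yz xz.
have ne (u v : T) : pos u != pos v -> (u == v) = false.
  by move=> h; apply/negbTE; apply: contraNneq h => ->.
rewrite /noncol /= /twin_dist.
have yx : pos y != pos x by rewrite eq_sym.
have zy : pos z != pos y by rewrite eq_sym.
rewrite !ne // (negbTE xy) (negbTE yz) (negbTE xz) (negbTE yx) (negbTE zy) /absd.
by lia.
Qed.

(** A point at distance 1 from the twins lies between them, as 2 = 1 + 1; a point farther away is in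
    no betweenness with both. *)
Lemma twin_noncol2 (T : finType) (pos : T -> nat) (x y z : T) :
  x != y -> pos x = pos y -> pos x != pos z ->
  noncol (S := twin_structure pos) x y z = (1 < absd (pos x) (pos z)).
Proof.
move=> xy e xz.
have ne (u v : T) : pos u != pos v -> (u == v) = false.
  by move=> h; apply/negbTE; apply: contraNneq h => ->.
have yz : pos y != pos z by rewrite -e.
have zy : pos z != pos y by rewrite eq_sym.
rewrite /noncol /= /twin_dist (eq_sym y x) (negbTE xy) !ne //.
by rewrite -e eqxx (negbTE xz) (eq_sym (pos z)) (negbTE xz) /absd; lia.
Qed.

Lemma linear_structure_exists n : 0 < n ->
  exists S, [/\ betweenness S, #|S| = n & cosize S = 0].
Proof.
move=> n0; exists (twin_structure (@nat_of_ord n)).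
have HS : betweenness (twin_structure (@nat_of_ord n)).
  by apply: twin_betweenness; rewrite card_ord.
split=> //; first by rewrite [LHS]card_ord.
apply: eq_card0 => T; apply/negbTE/(triangleP HS) => -[x [y [z [_ n3]]]].
have [xy yz xz] := noncol_neq HS n3.
by rewrite twin_noncol in n3.
Qed.

Section TwoTwins.
Context (n : nat) (n6 : 6 <= n).

(* The twins are 1, 2 and 3, 4. *)
Definition twin_pos (i : 'I_n) : nat :=
  if i <= 0 then 0 else if i <= 2 then 1 else if i <= 4 then 2 else i - 2.

Let S := twin_structure twin_pos.

Lemma twins_betweenness : betweenness S.
Proof. by apply: twin_betweenness; rewrite card_ord; lia. Qed.

Let o (k : nat) : 'I_n := insubd (Ordinal n6) k.

Lemma val_o k : k < n -> o k = k :> nat.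
Proof. by move=> kn; rewrite val_insubd kn. Qed.

(** The points at distance 1 from the twins 1, 2 are 0, 3, 4, and those at distance 1 from 3, 4 are
    1, 2, 5. All others give triangles, n - 5 for each pair. *)
Definition twinsA := [set [set o 1; o 2; k] | k : 'I_n & 5 <= k].
Definition twinsB := [set [set o 3; o 4; k] | k : 'I_n & (k == 0 :> nat) || (6 <= k)].

Lemma triangles_twins : triangles S = twinsA :|: twinsB.
Proof.
have HS := twins_betweenness.
have oE k : k <= 5 -> o k = k :> nat by move=> h; rewrite val_o //; lia.
have posE k : k <= 5 -> twin_pos (o k) =
  if k <= 0 then 0 else if k <= 2 then 1 else if k <= 4 then 2 else k - 2.
  by move=> h; rewrite /twin_pos oE.
have key (x y z : 'I_n) : x != y -> twin_pos x = twin_pos y -> noncol (S := S) x y z ->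
    [set x; y; z] \in twinsA :|: twinsB.
  move=> xy e h; have [_ yz xz] := noncol_neq HS h.
  have nz : twin_pos x != twin_pos z.
    move: xy yz xz e; rewrite -!val_eqE /= /twin_pos; clear.
    by move: (nat_of_ord x) (nat_of_ord y) (nat_of_ord z) => a b c; ifs_lia; lia.
  move: h; rewrite twin_noncol2 // => h.
  have vals : [\/ (x = 1 :> nat /\ y = 2 :> nat) \/ (x = 2 :> nat /\ y = 1 :> nat) |
     (x = 3 :> nat /\ y = 4 :> nat) \/ (x = 4 :> nat /\ y = 3 :> nat)].
    move: xy e; rewrite -!val_eqE /= /twin_pos; clear.
    move: (nat_of_ord x) (nat_of_ord y) => a b.
    by ifs_lia; lia.
  have toO (u : 'I_n) k : k <= 5 -> u = k :> nat -> u = o k.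
    by move=> k5 uk; apply: val_inj; rewrite /= oE.
  rewrite inE; apply/orP; case: vals => vals; [left|right]; apply/imsetP; exists z.
  - rewrite inE; move: h; case: vals => -[ex ey]; rewrite /absd /twin_pos ex /=; clear.
      by move: (nat_of_ord z) => c; ifs_lia; lia.
    by move: (nat_of_ord z) => c; ifs_lia; lia.
  - case: vals => -[ex ey]; rewrite (toO _ _ _ ex) ?(toO _ _ _ ey) //.
    by rewrite (setUC [set o 2]).
  - rewrite inE; move: h; case: vals => -[ex ey]; rewrite /absd /twin_pos ex /=; clear.
      by move: (nat_of_ord z) => c; ifs_lia; lia.
    by move: (nat_of_ord z) => c; ifs_lia; lia.
  - case: vals => -[ex ey]; rewrite (toO _ _ _ ex) ?(toO _ _ _ ey) //.
    by rewrite (setUC [set o 4]).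
apply/setP => T; apply/(triangleP HS)/idP.
  case=> x [y [z [-> h]]]; have [xy yz xz] := noncol_neq HS h.
  case: (eqVneq (twin_pos x) (twin_pos y)) => e1; first exact: key.
  case: (eqVneq (twin_pos y) (twin_pos z)) => e2.
    have -> : [set x; y; z] = [set y; z; x] by rewrite -setUA setUC.
    by apply: key => //; rewrite (noncolCr HS) (noncolC HS).
  case: (eqVneq (twin_pos x) (twin_pos z)) => e3.
    have -> : [set x; y; z] = [set x; z; y] by rewrite -!setUA (setUC [set y]).
    by apply: key => //; rewrite (noncolCr HS).
  by rewrite (twin_noncol e1 e2 e3) in h.
rewrite inE => /orP[] /imsetP[k]; rewrite inE => hk ->.
  exists (o 1), (o 2), k; split=> //; rewrite twin_noncol2.
  - by rewrite posE // /absd /twin_pos /=; move: hk; clear; move: (nat_of_ord k) => c; ifs_lia; lia.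
  - by rewrite -val_eqE /= !oE.
  - by rewrite !posE.
  - by rewrite posE // /twin_pos /=; move: hk; clear; move: (nat_of_ord k) => c; ifs_lia; lia.
exists (o 3), (o 4), k; split=> //; rewrite twin_noncol2.
- by rewrite posE // /absd /twin_pos /=; move: hk; clear; move: (nat_of_ord k) => c; ifs_lia; lia.
- by rewrite -val_eqE /= !oE.
- by rewrite !posE.
- by rewrite posE // /twin_pos /=; move: hk; clear; move: (nat_of_ord k) => c; ifs_lia; lia.
Qed.

Lemma card_ord_pred (P : pred nat) : #|[set k : 'I_n | P k]| = count P (iota 0 n).
Proof.
rewrite cardsE cardE size_filter -val_enum_ord count_map.
by rewrite enumT.
Qed.

Lemma cosize_twins : cosize S = 2 * n - 10.
Proof.
have oE k : k <= 5 -> o k = k :> nat by move=> h; rewrite val_o //; lia.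
have oE' i j : i <= 5 -> j <= 5 -> (o i == o j) = (i == j).
  by move=> i5 j5; rewrite -val_eqE /= !oE.
have kE (k : 'I_n) i : i <= 5 -> (o i == k) = (i == k :> nat).
  by move=> i5; rewrite -val_eqE /= oE.
have kE' (k : 'I_n) i : i <= 5 -> (k == o i) = (i == k :> nat).
  by move=> i5; rewrite eq_sym kE.
have split_n : iota 0 n = iota 0 6 ++ iota 6 (n - 6).
  by rewrite -iotaD; congr iota; lia.
have cnt (P : pred nat) : (forall k, 6 <= k -> P k) ->
    count P (iota 0 n) = count P (iota 0 6) + (n - 6).
  move=> h; rewrite split_n count_cat; congr (_ + _).
  rewrite -[RHS](size_iota 6); apply/eqP; rewrite -all_count.
  by apply/allP => k; rewrite mem_iota => /andP[/h].
rewrite /cosize triangles_twins cardsU.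
have -> : twinsA :&: twinsB = set0.
  apply/setP => T; rewrite !inE; apply/negP => /andP[/imsetP [k hk ->] /imsetP [k' hk' e]].
  have : o 1 \in [set o 3; o 4; k'] by rewrite -e !inE eqxx.
  rewrite !inE !oE' // kE //=; move: hk'; rewrite inE; lia.
have inj i j (P : pred nat) : i <= 5 -> j <= 5 -> (forall k, P k -> k != i /\ k != j) ->
    {in [set k : 'I_n | P k] &, injective (fun k : 'I_n => [set o i; o j; k])}.
  move=> i5 j5 hP k k'; rewrite !inE => /hP [k1 k2] /hP [k3 k4] e.
  have : k \in [set o i; o j; k'] by rewrite -e !inE eqxx !orbT.
  by rewrite !inE !kE' // !(eq_sym _ (val k)) (negbTE k1) (negbTE k2) => /eqP.
rewrite cards0 subn0 !card_in_imset; first last.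
- by apply: (inj _ _ (fun k => 5 <= k)) => // k; lia.
- by apply: (inj _ _ (fun k => (k == 0) || (6 <= k))) => // k; lia.
rewrite (card_ord_pred (fun k => 5 <= k)) (card_ord_pred (fun k => (k == 0) || (6 <= k))).
rewrite !cnt /=; lia.
Qed.

(** The triangles {1, 2, 5} and {3, 4, 0} are disjoint, so a kernel would have to be empty. *)
Lemma twins_not_tight_star : ~ tight_star (triangles S).
Proof.
have oE k : k <= 5 -> o k = k :> nat by move=> h; rewrite val_o //; lia.
have oE' i j : i <= 5 -> j <= 5 -> (o i == o j) = (i == j).
  by move=> i5 j5; rewrite -val_eqE /= !oE.
have tA : [set o 1; o 2; o 5] \in triangles S.
  by rewrite triangles_twins inE; apply/orP; left; apply/imsetP; exists (o 5); rewrite ?inE ?oE.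
have tB : [set o 3; o 4; o 0] \in triangles S.
  by rewrite triangles_twins inE; apply/orP; right; apply/imsetP; exists (o 0); rewrite ?inE ?oE.
have disj : [set o 1; o 2; o 5] :&: [set o 3; o 4; o 0] = set0.
  apply/setP => k; rewrite !inE -!orbA; apply/negP => /andP[].
  by case/or3P => /eqP ->; rewrite !oE'.
have ne : [set o 1; o 2; o 5] != [set o 3; o 4; o 0].
  apply/eqP => e; move: disj; rewrite e setIid => /setP /(_ (o 3)).
  by rewrite !inE eqxx.
case=> [one|[K K2 ds]].
  have /cards1P [T eT] : #|triangles S| == 1 by apply/eqP.
  by move: tA tB; rewrite eT !in_set1 => /eqP ea /eqP eb; rewrite ea eb eqxx in ne.
by have := ds _ _ tA tB ne; rewrite disj => e; rewrite -e cards0 in K2.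
Qed.
End TwoTwins.

(** * Classification *)

Lemma classification S n : betweenness S -> #|S| = n -> 0 < cosize S -> cosize S + 11 <= 2 * n ->
  [\/ cosize S = n - 4 /\ ((exists2 k, 1 <= k <= n - 3 & frame S n.-1 (tab_R k L R)) \/
        frame S n.-1 (tab_S n.-1 R M)),
      cosize S = n - 3 /\ [\/ frame S n.-1 (tab_Q R),
        exists2 k, 1 <= k <= n - 3 & frame S n.-1 (tab_R k L O) |
        frame S n.-1 (tab_S n.-1 R O) \/ frame S n.-1 (tab_S n.-1 O M)]
    | cosize S = n - 2 /\ [\/ frame S n.-1 (tab_Q O),
        exists2 k, 1 <= k <= n - 3 & frame S n.-1 (tab_R k O O) |
        frame S n.-1 (tab_S n.-1 O O)]].
Proof.
move=> HS cS pos le; have le' : cosize S + 11 <= 2 * #|S| by rewrite cS.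
have [t fr pt] := pattern_frame HS pos le'; rewrite cS in fr pt.
have cE := frame_cosize HS fr.
case: pt => [e|k kN e|k u v k0 kN hu hv e|x hx e|x z hx hz e]; have {}fr := frame_same e fr;
  rewrite (off_same e) in cE.
- by rewrite off_L in cE; lia.
- by rewrite off_ins in cE; lia.
- rewrite off_R // in cE.
  have kn : 1 <= k <= n - 3 by lia.
  (* Reversal serves the choice (O, R), which becomes (L, O) at the mirrored position. *)
  have fr' := frame_same (rev_tab_R u v k0 kN) (frame_rev HS fr).
  case: hu hv => -> [] -> in cE fr fr' {e}; rewrite /= in cE fr'.
  + by apply: Or31; split; [lia|left; exists k].
  + by apply: Or32; split; [lia|apply: Or32; exists k].
  + by apply: Or32; split; [lia|apply: Or32; exists (n.-2 - k); rewrite //; lia].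
  + by apply: Or33; split; [lia|apply: Or32; exists k].
- rewrite off_Q // in cE; last lia.
  case: hx => -> in cE fr {e}; rewrite /= in cE.
    by apply: Or32; split; [lia|apply: Or31].
  by apply: Or33; split; [lia|apply: Or31].
rewrite off_S // in cE; last lia.
case: hx hz => -> [] -> in cE fr {e}; rewrite /= in cE.
- by apply: Or31; split; [lia|right].
- by apply: Or32; split; [lia|apply: Or33; left].
- by apply: Or32; split; [lia|apply: Or33; right].
- by apply: Or33; split; [lia|apply: Or33].
Qed.

(** When [u = swap v] the reversed table has the same letters at position n - 2 - k, so k may be
    taken in the first half. [I4] has the same body as [I2], so both families are covered. *)
Lemma tab_R_half S n k u v : betweenness S -> u = swap v -> 1 <= k <= n - 3 ->
  frame S n.-1 (tab_R k u v) -> exists2 i, I2 n i & frame S n.-1 (tab_R i u v).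
Proof.
move=> HS uv hk fr; have vu : v = swap u by rewrite uv swapK.
rewrite /I2 uphalf_half.
case: (leqP k (odd (n - 3) + (n - 3)./2)) => h.
  by exists k => //; rewrite h; case/andP: hk => ->.
have k0 : 0 < k by lia.
have kN : k.+1 < n.-1 by lia.
exists (n.-2 - k); last first.
  by have := frame_same (rev_tab_R u v k0 kN) (frame_rev HS fr); rewrite -uv -vu.
by move: (odd_double_half (n - 3)); lia.
Qed.

Lemma isomorphic_cosize S T n t : isomorphic S T -> betweenness T -> frame T n.-1 t -> 0 < n ->
  [/\ betweenness S, #|S| = n & cosize S = off n.-1 t].
Proof.
move=> iso HT fT n0; have HS := isomorphic_betweenness iso HT.
have fS := isomorphic_frame iso fT.
split=> //; last exact: frame_cosize.
by case: fS => p [y [_ _ -> _]]; rewrite prednK.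
Qed.

(** * The tables realized by the graphs, and the three families *)

Section Models.
Context (F : realType) (n : nat).

Lemma Q_betweenness d tl : 3 <= n -> tail_for d tl -> betweenness (induced_of F n (Q_graph n tl)).
Proof. by move=> n3 hd; apply: (induced_betweenness F _ (Q_geodesic n3 hd)); lia. Qed.

Lemma R_betweenness i g d tl : 4 <= n -> 1 <= i <= n - 3 -> g = 1 \/ g = 2 -> tail_for d tl ->
  betweenness (induced_of F n (R_graph n i g tl)).
Proof.
by move=> n4 hi hg hd; apply: (induced_betweenness F _ (R_geodesic n4 hi hg hd)); lia.
Qed.

Lemma S_betweenness h d : 4 <= n -> 0 < h -> 0 < d -> d < n - 2 + h -> n - 4 + h <= d ->
  n - 2 <= d + h -> betweenness (induced_of F n (S_graph n h d)).
Proof.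
move=> n4 h0 d0 d1 d2 d3.
by apply: (induced_betweenness F _ (S_geodesic n4 h0 d0 d1 d2 d3)); lia.
Qed.

Lemma Q3_model : 3 <= n -> betweenness (struct_Q3 F n) /\ frame (struct_Q3 F n) n.-1 (tab_Q R).
Proof.
move=> n3; have hd : tail_for 2 [::] by left.
by split; [apply: Q_betweenness hd|apply: (Q_frame F n3 hd)].
Qed.

Lemma Q2_model : 3 <= n -> betweenness (struct_Q2 F n) /\ frame (struct_Q2 F n) n.-1 (tab_Q O).
Proof.
move=> n3; have hd : tail_for 1 [:: (vy, vz, 1)] by right.
by split; [apply: Q_betweenness hd|apply: (Q_frame F n3 hd)].
Qed.

Lemma R4_model i : 4 <= n -> 1 <= i <= n - 3 ->
  betweenness (struct_R4 F n i) /\ frame (struct_R4 F n i) n.-1 (tab_R i L R).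
Proof.
move=> n4 hi; have hd : tail_for 2 [::] by left.
have hg : 1 = 1 \/ 1 = 2 by left.
by split; [apply: R_betweenness hg hd|apply: (R_frame F n4 hi hg hd)].
Qed.

Lemma R3_model i : 4 <= n -> 1 <= i <= n - 3 ->
  betweenness (struct_R3 F n i) /\ frame (struct_R3 F n i) n.-1 (tab_R i L O).
Proof.
move=> n4 hi; have hd : tail_for 2 [::] by left.
have hg : 2 = 1 \/ 2 = 2 by right.
by split; [apply: R_betweenness hg hd|apply: (R_frame F n4 hi hg hd)].
Qed.

Lemma R2_model i : 4 <= n -> 1 <= i <= n - 3 ->
  betweenness (struct_R2 F n i) /\ frame (struct_R2 F n i) n.-1 (tab_R i O O).
Proof.
move=> n4 hi; have hd : tail_for 1 [:: (vy, vz, 1)] by right.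
have hg : 1 = 1 \/ 1 = 2 by left.
by split; [apply: R_betweenness hg hd|apply: (R_frame F n4 hi hg hd)].
Qed.

Lemma S4_model : 5 <= n ->
  betweenness (struct_S4 F n) /\ frame (struct_S4 F n) n.-1 (tab_S n.-1 R M).
Proof.
move=> n5; split; first by apply: S_betweenness; lia.
have e1 : (n - 3 + 1 == n - 2) by lia.
have e2 : (n - 3 == n - 4 + 1) by lia.
by have := @S_frame F n 1 (n - 3); rewrite e1 e2; apply; lia.
Qed.

(** The classification produces both tables as separate cases; having both frames identifies them as
    one isomorphism class. *)
Lemma S3_model : 4 <= n -> [/\ betweenness (struct_S3 F n),
  frame (struct_S3 F n) n.-1 (tab_S n.-1 O M) & frame (struct_S3 F n) n.-1 (tab_S n.-1 R O)].
Proof.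
move=> n4; split; [by apply: S_betweenness; lia| |exact: S3_frame_z].
have e1 : (n - 2 + 2 == n - 2) = false by lia.
have e2 : (n - 2 == n - 4 + 2) by lia.
by have := @S_frame F n 2 (n - 2); rewrite e1 e2; apply; lia.
Qed.

Lemma S2_model : 4 <= n ->
  betweenness (struct_S2 F n) /\ frame (struct_S2 F n) n.-1 (tab_S n.-1 O O).
Proof.
move=> n4; split; first by apply: S_betweenness; lia.
have e1 : (n - 2 + 1 == n - 2) = false by lia.
have e2 : (n - 2 == n - 4 + 1) = false by lia.
by have := @S_frame F n 1 (n - 2); rewrite e1 e2; apply; lia.
Qed.

Lemma I2_bounds i : 4 <= n -> I2 n i -> 1 <= i <= n - 3.
Proof.
rewrite /I2 uphalf_half => n4 /andP[-> h] /=; apply: leq_trans h _.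
by move: (odd_double_half (n - 3)); lia.
Qed.

Lemma cosize_n4 S : 7 <= n ->
  [/\ betweenness S, #|S| = n & cosize S = n - 4] <->
  (exists2 i, I4 n i & isomorphic S (struct_R4 F n i)) \/ isomorphic S (struct_S4 F n).
Proof.
move=> n7; have n4 : 4 <= n by lia.
have n5 : 5 <= n by lia.
have n0 : 0 < n by lia.
split.
  case=> HS cS e.
  have pos : 0 < cosize S by lia.
  have le : cosize S + 11 <= 2 * n by lia.
  case: (classification HS cS pos le) => -[e' c]; try (exfalso; lia).
  case: c => [[k hk fr]|fr].
    have [i hi fi] := tab_R_half HS (erefl : L = swap R) hk fr.
    left; exists i => //.
    have [HT fT] := R4_model n4 (I2_bounds n4 hi).
    exact: frame_isomorphic fi fT.
  right; have [HT fT] := S4_model n5.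
  exact: frame_isomorphic fr fT.
case=> [[i hi iso]|iso].
  have hi' := I2_bounds n4 hi.
  have [HT fT] := R4_model n4 hi'.
  have [HS cS ->] := isomorphic_cosize iso HT fT n0.
  by rewrite off_R; try lia; [split=> //=; lia|left|left].
have [HT fT] := S4_model n5.
have [HS cS ->] := isomorphic_cosize iso HT fT n0.
by rewrite off_S; try lia; [split=> //=; lia|left|left].
Qed.

Lemma cosize_n3 S : 8 <= n ->
  [/\ betweenness S, #|S| = n & cosize S = n - 3] <->
  [\/ isomorphic S (struct_Q3 F n), exists2 i, I3 n i & isomorphic S (struct_R3 F n i)
    | isomorphic S (struct_S3 F n)].
Proof.
move=> n8; have n4 : 4 <= n by lia.
have n3 : 3 <= n by lia.
have n0 : 0 < n by lia.
split.
  case=> HS cS e.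
  have pos : 0 < cosize S by lia.
  have le : cosize S + 11 <= 2 * n by lia.
  case: (classification HS cS pos le) => -[e' c]; try (exfalso; lia).
  have [HT fT fT'] := S3_model n4.
  case: c => [fr|[i hi fr]|[fr|fr]].
  - by have [HQ fQ] := Q3_model n3; apply: Or31; apply: frame_isomorphic fr fQ.
  - have [HR fR] := R3_model n4 hi; apply: Or32; exists i => //.
    exact: frame_isomorphic fr fR.
  - by apply: Or33; apply: frame_isomorphic fr fT'.
  - by apply: Or33; apply: frame_isomorphic fr fT.
case=> [iso|[i hi iso]|iso].
- have [HT fT] := Q3_model n3.
  have [HS cS ->] := isomorphic_cosize iso HT fT n0.
  by rewrite off_Q; try lia; [split=> //=; lia|left].
- have [HT fT] := R3_model n4 hi.
  have [HS cS ->] := isomorphic_cosize iso HT fT n0.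
  by move: hi; rewrite /I3 => hi; rewrite off_R; try lia; [split=> //=; lia|left|right].
have [HT fT _] := S3_model n4.
have [HS cS ->] := isomorphic_cosize iso HT fT n0.
by rewrite off_S; try lia; [split=> //=; lia|right|left].
Qed.

Lemma cosize_n2 S : 9 <= n ->
  [/\ betweenness S, #|S| = n & cosize S = n - 2] <->
  [\/ isomorphic S (struct_Q2 F n), exists2 i, I2 n i & isomorphic S (struct_R2 F n i)
    | isomorphic S (struct_S2 F n)].
Proof.
move=> n9; have n4 : 4 <= n by lia.
have n3 : 3 <= n by lia.
have n0 : 0 < n by lia.
split.
  case=> HS cS e.
  have pos : 0 < cosize S by lia.
  have le : cosize S + 11 <= 2 * n by lia.
  case: (classification HS cS pos le) => -[e' c]; try (exfalso; lia).
  case: c => [fr|[k hk fr]|fr].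
  - by have [HQ fQ] := Q2_model n3; apply: Or31; apply: frame_isomorphic fr fQ.
  - have [i hi fi] := tab_R_half HS (erefl : O = swap O) hk fr.
    have [HR fR] := R2_model n4 (I2_bounds n4 hi); apply: Or32; exists i => //.
    exact: frame_isomorphic fi fR.
  - by have [HT fT] := S2_model n4; apply: Or33; apply: frame_isomorphic fr fT.
case=> [iso|[i hi iso]|iso].
- have [HT fT] := Q2_model n3.
  have [HS cS ->] := isomorphic_cosize iso HT fT n0.
  by rewrite off_Q; try lia; [split=> //=; lia|right].
- have hi' := I2_bounds n4 hi.
  have [HT fT] := R2_model n4 hi'.
  have [HS cS ->] := isomorphic_cosize iso HT fT n0.
  by rewrite off_R; try lia; [split=> //=; lia|right|right].
have [HT fT] := S2_model n4.
have [HS cS ->] := isomorphic_cosize iso HT fT n0.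
by rewrite off_S; try lia; [split=> //=; lia|right|right].
Qed.

End Models.

(** Outside the range of the classification the co-size is at least 2n - 10, which is at least n - 4
    for n >= 6; for smaller n positivity suffices. *)
Lemma cosize_lower S n : betweenness S -> #|S| = n -> 0 < cosize S -> n - 4 <= cosize S.
Proof.
move=> HS cS pos; case: (leqP (cosize S + 11) (2 * n)) => le.
  by case: (classification HS cS pos le) => -[-> _]; lia.
by lia.
Qed.

Lemma isomorphic_refl S : isomorphic S S.
Proof. by exists id => //; exists id. Qed.

Lemma cosize_exists (F : realType) n c : 2 <= c <= 4 -> c <= n ->
  exists S, [/\ betweenness S, #|S| = n & cosize S = n - c].
Proof.
move=> hc cn; have n0 : 0 < n by lia.
case: (eqVneq n c) => [e|ne].
  by rewrite -e subnn; apply: linear_structure_exists.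
have n3 : 3 <= n by lia.
have [e|[e|e]] : c = 2 \/ c = 3 \/ c = 4 by lia.
- have [HT fT] := Q2_model F n3; exists (struct_Q2 F n).
  have [HS cS ->] := isomorphic_cosize (isomorphic_refl _) HT fT n0.
  by rewrite off_Q; try lia; [split=> //=; lia|right].
- have [HT fT] := Q3_model F n3; exists (struct_Q3 F n).
  have [HS cS ->] := isomorphic_cosize (isomorphic_refl _) HT fT n0.
  by rewrite off_Q; try lia; [split=> //=; lia|left].
have n5 : 5 <= n by lia.
have [HT fT] := S4_model F n5; exists (struct_S4 F n).
have [HS cS ->] := isomorphic_cosize (isomorphic_refl _) HT fT n0.
by rewrite off_S; try lia; [split=> //=; lia|left|left].
Qed.

End Development.

Local Open Scope ring_scope.

Theorem theorem4 (R : realType) (c : int) (n : nat) (hn : (0 < n)%N) :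
  let N : int := 11%:Z - c in
  let m : int := n%:Z - c in
  [/\          
      4%:Z < c ->
        (n%:Z <> c -> forall S : structure, ~ in_B n m S) /\
        (n%:Z = c ->
           (exists S : structure, in_B n m S) /\
           forall S : structure,
             in_B n m S <->
             [/\ betweenness S, order_of S = n & linear_structure S]),
               
      2%:Z <= c <= 4%:Z ->
        ((exists S : structure, in_B n m S) <-> c <= n%:Z) /\
        (N <= n%:Z ->
           forall S : structure,
             [/\ c = 4%:Z ->
                   (in_B n m S <->
                    (exists2 i : nat, I4 n i & isomorphic S (struct_R4 R n i)) \/
                    isomorphic S (struct_S4 R n)),
                 c = 3%:Z ->
                   (in_B n m S <->
                    [\/ isomorphic S (struct_Q3 R n),
                        exists2 i : nat, I3 n i & isomorphic S (struct_R3 R n i)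
                      | isomorphic S (struct_S3 R n)])
               & c = 2%:Z ->
                   (in_B n m S <->
                    [\/ isomorphic S (struct_Q2 R n),
                        exists2 i : nat, I2 n i & isomorphic S (struct_R2 R n i)
                      | isomorphic S (struct_S2 R n)])]),
               
      c < 2%:Z -> N <= n%:Z -> forall S : structure, ~ in_B n m S
    &          
      c <= 4%:Z -> n%:Z = N - 1 ->
        (exists S : structure, in_B n m S) /\
        (exists2 S : structure, in_B n m S & ~ tight_star (triangles S))].
Proof.
move=> N m.
have in_BE k S : m = k%:Z -> in_B n m S <-> [/\ betweenness S, #|S| = n & cosize S = k].
  move=> ->; split=> -[HS cS e]; split=> //; first by case: e.
  by rewrite e.
have not_B S : m < 0 -> ~ in_B n m S by move=> m0 [_ _ e]; rewrite -e in m0.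
split.
- move=> c4; split.
    move=> nc S [HS cS e]; have := cosize_lower HS cS.
    by move: e nc c4; rewrite /m; move: (cosize S) => k; lia.
  move=> nc; have m0 : m = 0 by rewrite /m nc subrr.
  split.
    have [S h] := linear_structure_exists hn; exists S.
    by apply/(in_BE 0%N S m0).
  by move=> S; apply: (in_BE 0%N S m0).
- move=> hc; split.
    split=> [[S [HS cS e]]|cn]; first by move: e; rewrite /m; lia.
    pose k := `|c|%N.
    have ck : c = k%:Z by rewrite /k; lia.
    have [|| S h] := @cosize_exists R n k; [by lia|by lia|].
    by exists S; apply/(in_BE (n - k)%N S) => //; rewrite /m ck; lia.
  rewrite /N => Nn S; split=> ec.
  + rewrite (in_BE (n - 4)%N S); last by rewrite /m ec; lia.
    by apply: cosize_n4; lia.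
  + rewrite (in_BE (n - 3)%N S); last by rewrite /m ec; lia.
    by apply: cosize_n3; lia.
  + rewrite (in_BE (n - 2)%N S); last by rewrite /m ec; lia.
    by apply: cosize_n2; lia.
(* The co-size n - c is at most 2n - 11 but exceeds n - 2, the largest value that the classification
   permits. *)
- rewrite /N => c2 Nn S [HS cS e].
  have pos : (0 < cosize S)%N by move: e; rewrite /m; lia.
  have le : (cosize S + 11 <= 2 * n)%N by move: e; rewrite /m; lia.
  by case: (classification HS cS pos le) => -[e' _]; move: e; rewrite e' /m; lia.
(* Here n = 10 - c, so n >= 6 and n - c = 2n - 10, the co-size of the two pairs of twins. *)
rewrite /N => c4 nE; have n6 : (6 <= n)%N by lia.
have inB : in_B n m (twin_structure (@twin_pos n)).
  split; [exact: twins_betweenness|by rewrite /order_of [LHS]card_ord|].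
  by rewrite cosize_twins // /m; lia.
split; first by exists (twin_structure (@twin_pos n)).
by exists (twin_structure (@twin_pos n)) => //; apply: twins_not_tight_star.
Qed.
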